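(* Let $q\in\mathbb{C}\setminus\{0\}$ be not a root of unity, and let $\mathcal{A}_q=\mathcal{A}_q(x,\xi,\theta,z)$ be the algebra of polynomials on the double-graded quantum superplane. The following coproduct $\Delta:\mathcal{A}_q\to\mathcal{A}_q\otimes\mathcal{A}_q$ and counit $\epsilon:\mathcal{A}_q\to\mathbb{C}$, given on generators (and extended as morphisms of unital algebras, with $\mathcal{A}_q\otimes\mathcal{A}_q$ carrying the $\mathbb{Z}_2^2$-graded tensor product multiplication), provide $\mathcal{A}_q$ with the structure of a $\mathbb{Z}_2^2$-bialgebra: $$\Delta(x)=x\otimes x,\quad \Delta(\xi)=x\otimes\xi+\xi\otimes x,\quad \Delta(\theta)=x\otimes\theta+\theta\otimes x,\quad \Delta(z)=x\otimes z+z\otimes x,$$ $$\epsilon(x)=1,\qquad \epsilon(\xi)=\epsilon(\theta)=\epsilon(z)=0.$$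
   Context: The base field is $\mathbb{C}$, $\mathbb{Z}_2^2=\mathbb{Z}_2\times\mathbb{Z}_2$, and $\langle(a,b),(a',b')\rangle=aa'+bb'$. $\mathcal{A}_q=\mathcal{A}_q(x,\xi,\theta,z)$ is the $\mathbb{Z}_2^2$-graded, associative, unital algebra generated by $x,\xi,\theta,z$ of degrees $\deg x=(0,0)$, $\deg\xi=(0,1)$, $\deg\theta=(1,0)$, $\deg z=(1,1)$, subject to (i.e. the quotient of the free algebra by the ideal generated by) the relations $$x\xi=q\,\xi x,\quad x\theta=q\,\theta x,\quad xz=zx,\quad \xi^2=0,\quad \theta^2=0,\quad \xi\theta=\theta\xi,\quad \xi z=-q^{-1}z\xi,\quad \theta z=-q^{-1}z\theta.$$ The $\mathbb{Z}_2^2$-graded tensor product of $\mathbb{Z}_2^2$-graded algebras has multiplication $(a\otimes b)(c\otimes d)=(-1)^{\langle\deg b,\deg c\rangle}ac\otimes bd$ for homogeneous elements. A $\mathbb{Z}_2^2$-coalgebra is a $\mathbb{Z}_2^2$-graded vector space $\mathcal{C}$ with grading-preserving linear maps $\Delta:\mathcal{C}\to\mathcal{C}\otimes\mathcal{C}$, $\epsilon:\mathcal{C}\to\mathbb{C}$ such that $(\Delta\otimes\mathrm{Id})\circ\Delta=(\mathrm{Id}\otimes\Delta)\circ\Delta$ and $(\epsilon\otimes\mathrm{Id})\circ\Delta=(\mathrm{Id}\otimes\epsilon)\circ\Delta=\mathrm{Id}$ (using $\mathbb{C}\otimes\mathcal{C}\cong\mathcal{C}\cong\mathcal{C}\otimes\mathbb{C}$).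 A $\mathbb{Z}_2^2$-bialgebra is a $\mathbb{Z}_2^2$-graded associative unital algebra that is also a $\mathbb{Z}_2^2$-coalgebra, such that $\Delta$ and $\epsilon$ are (grading-preserving) morphisms of unital algebras. *)

(* Defs.v *)
From HB Require Import structures.
From mathcomp Require Import all_boot all_order all_algebra.
From mathcomp Require Import finmap.
From mathcomp Require Import boolp classical_sets reals.
From mathcomp Require Import complex.
From mathcomp Require Import monalg.

Set Implicit Arguments.
Unset Strict Implicit.
Unset Printing Implicit Defensive.

Import GRing.Theory.
Local Open Scope ring_scope.

Section LinearMaps.
Variables (K : fieldType) (V W : lmodType K) (f : V -> W).
Hypothesis lf : linear f.

Lemma linD : {morph f : x y / x + y}.
Proof. by move=> x y; rewrite -[x in LHS]scale1r lf scale1r. Qed.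
Lemma lin0 : f 0 = 0.
Proof. by apply: (addrI (f 0)); rewrite -linD !addr0. Qed.
Lemma linZ c : {morph f : x / c *: x}.
Proof. by move=> x; rewrite -[_ *: x in LHS]addr0 lf lin0 addr0. Qed.
Lemma linB : {morph f : x y / x - y}.
Proof. by move=> x y; rewrite -scaleN1r linD linZ scaleN1r. Qed.
Lemma lin_sum I (r : seq I) (P : pred I) (F : I -> V) :
  f (\sum_(i <- r | P i) F i) = \sum_(i <- r | P i) f (F i).
Proof. exact: (big_morph f linD lin0). Qed.
End LinearMaps.

Inductive span (K : fieldType) (V : lmodType K) (S : V -> Prop) : V -> Prop :=
| span_gen v : S v -> span S v
| span_zero : span S 0
| span_add v w : span S v -> span S w -> span S (v + w)
| span_scale c v : span S v -> span S (c *: v).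

Section LinearQuotient.
Variables (K : fieldType) (V : lmodType K) (S : V -> Prop).

Definition spanp : {pred V} := fun v => `[< span S v >].

Lemma spanpP v : reflect (span S v) (v \in spanp).
Proof. exact: asboolP. Qed.

Lemma spanp_zmod_closed : zmod_closed spanp.
Proof.
split; first by apply/spanpP/span_zero.
move=> v w /spanpP hv /spanpP hw; apply/spanpP/span_add => //.
by rewrite -scaleN1r; apply: span_scale.
Qed.

HB.instance Definition _ := GRing.isZmodClosed.Build V spanp spanp_zmod_closed.

Definition lquot : Type := Quotient.quot spanp.
HB.instance Definition _ := GRing.Zmodule.on lquot.

End LinearQuotient.

HB.lock Definition lpi (K : fieldType) (V : lmodType K) (S : V -> Prop)
  (v : V) : lquot S := \pi_(Quotient.quot (spanp S))%qT v.
HB.lock Definition lrepr (K : fieldType) (V : lmodType K) (S : V -> Prop)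
  (u : lquot S) : V := @repr V (Quotient.quot (spanp S)) u.
HB.lock Definition lquot_scale (K : fieldType) (V : lmodType K)
  (S : V -> Prop) (c : K) (u : lquot S) : lquot S := lpi S (c *: lrepr u).

Section LinearQuotientModule.
Variables (K : fieldType) (V : lmodType K) (S : V -> Prop).
Local Notation spanp := (spanp S).
Local Notation lpi := (@lpi K V S).
Local Notation lrepr := (@lrepr K V S).
Local Notation lquot := (lquot S).
Local Notation lquot_scale := (@lquot_scale K V S).

Lemma lreprK u : lpi (lrepr u) = u.
Proof. by rewrite lpi.unlock lrepr.unlock; exact: (@reprK V (Quotient.quot spanp) u). Qed.

Lemma lpi_eq v w : lpi v = lpi w <-> span S (v - w).
Proof.
rewrite lpi.unlock; split.
  by move/eqP; rewrite -[_ == _](Quotient.idealrBE spanp) => /(spanpP S).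
by move=> /(spanpP S) h; apply/eqP; rewrite -[_ == _](Quotient.idealrBE spanp).
Qed.

Lemma lpiD v w : lpi (v + w) = lpi v + lpi w.
Proof. by rewrite lpi.unlock; exact: (raddfD (\pi_(Quotient.quot spanp))%qT). Qed.

Lemma lpi_repr v : span S (lrepr (lpi v) - v).
Proof. by apply/lpi_eq; rewrite lreprK. Qed.

Lemma lquot_scaleE c v : lquot_scale c (lpi v) = lpi (c *: v).
Proof.
by rewrite lquot_scale.unlock; apply/lpi_eq; rewrite -scalerBr; apply/span_scale/lpi_repr.
Qed.

Lemma lquot_scalerA a b u :
  lquot_scale a (lquot_scale b u) = lquot_scale (a * b) u.
Proof. by rewrite -[u]lreprK !lquot_scaleE scalerA. Qed.
Lemma lquot_scale1r : left_id 1 lquot_scale.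
Proof. by move=> u; rewrite -[u]lreprK !lquot_scaleE scale1r. Qed.
Lemma lquot_scalerDr : right_distributive lquot_scale +%R.
Proof.
move=> a u w; rewrite -[u]lreprK -[w]lreprK.
by rewrite -lpiD !lquot_scaleE scalerDr lpiD.
Qed.
Lemma lquot_scalerDl u : {morph lquot_scale^~ u : a b / a + b}.
Proof. by move=> a b; rewrite -[u]lreprK !lquot_scaleE scalerDl lpiD. Qed.

HB.instance Definition _ := GRing.Zmodule_isLmodule.Build K lquot
  lquot_scalerA lquot_scale1r lquot_scalerDr lquot_scalerDl.

Lemma lpi_is_linear : linear lpi.
Proof. by move=> c v w; rewrite lpiD -[lpi (c *: v)]lquot_scaleE. Qed.

Lemma lquot_ext (U : lmodType K) (f : V -> U) : linear f ->
  (forall v, S v -> f v = 0) -> forall v, f (lrepr (lpi v)) = f v.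
Proof.
move=> lf f0 v.
apply/eqP; rewrite -subr_eq0 -(linB lf); apply/eqP.
elim: (lpi_repr v) => [w /f0 //||w w' _ e _ e'|c w _ e].
- exact: (lin0 lf).
- by rewrite (linD lf) e e' addr0.
- by rewrite (linZ lf) e scaler0.
Qed.

End LinearQuotientModule.

Section Tensor.
Variable K : fieldType.

Section TensorDef.
Variables V W : lmodType K.

Variant tensor_rel : {malg K[(V * W)%type]} -> Prop :=
| tensor_relDl v v' w :
    tensor_rel (<< (v + v', w) >> - << (v, w) >> - << (v', w) >>)
| tensor_relDr v w w' :
    tensor_rel (<< (v, w + w') >> - << (v, w) >> - << (v, w') >>)
| tensor_relZl c v w : tensor_rel (<< (c *: v, w) >> - c *: << (v, w) >>)
| tensor_relZr c v w : tensor_rel (<< (v, c *: w) >> - c *: << (v, w) >>).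

Definition tensor : Type := lquot tensor_rel.
HB.instance Definition _ := GRing.Lmodule.on tensor.

End TensorDef.

Definition bilin (V W U : lmodType K) (f : V -> W -> U) :=
  (forall w, linear (f^~ w)) /\ (forall v, linear (f v)).

End Tensor.

HB.lock Definition tens (K : fieldType) (V W : lmodType K) (v : V) (w : W) :
  tensor V W := lpi (@tensor_rel K V W) << (v, w) >>.

(* The linear map on the tensor product induced by [f]; it is meaningful
   (see [tlift_tens]) when [f] is bilinear. *)
HB.lock Definition tlift (K : fieldType) (V W U : lmodType K)
    (f : V -> W -> U) (t : tensor V W) : U :=
  let r := lrepr t in \sum_(k <- msupp r) r@_k *: f k.1 k.2.

Notation "V ⊗ W" := (tensor V W)
  (at level 40, left associativity) : type_scope.
Notation "v ⊗ w" := (tens v w)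
  (at level 40, left associativity) : ring_scope.

Section TensorTheory.
Variable K : fieldType.
Implicit Types V W U : lmodType K.

Lemma tens_linl V W (w : W) : linear (fun v : V => v ⊗ w).
Proof.
move=> c v v'; rewrite tens.unlock; set p := lpi _.
have -> : p << (c *: v + v', w) >> = p << (c *: v, w) >> + p << (v', w) >>.
  by rewrite -lpiD; apply/lpi_eq/span_gen; rewrite opprD addrA; apply: tensor_relDl.
congr (_ + _); rewrite -(linZ (@lpi_is_linear _ _ _)).
by apply/lpi_eq/span_gen/tensor_relZl.
Qed.

Lemma tens_linr V W (v : V) : linear (fun w : W => v ⊗ w).
Proof.
move=> c w w'; rewrite tens.unlock; set p := lpi _.
have -> : p << (v, c *: w + w') >> = p << (v, c *: w) >> + p << (v, w') >>.
  by rewrite -lpiD; apply/lpi_eq/span_gen; rewrite opprD addrA; apply: tensor_relDr.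
congr (_ + _); rewrite -(linZ (@lpi_is_linear _ _ _)).
by apply/lpi_eq/span_gen/tensor_relZr.
Qed.

Lemma tens_bilin V W : bilin (@tens K V W).
Proof. by split; [exact: tens_linl | exact: tens_linr]. Qed.

Lemma tens0l V W (w : W) : (0 : V) ⊗ w = 0.
Proof. exact: (lin0 (@tens_linl V W w)). Qed.
Lemma tens0r V W (v : V) : v ⊗ (0 : W) = 0.
Proof. exact: (lin0 (@tens_linr V W v)). Qed.
Lemma tensDl V W (v v' : V) (w : W) : (v + v') ⊗ w = v ⊗ w + v' ⊗ w.
Proof. exact: (linD (@tens_linl V W w)). Qed.
Lemma tensDr V W (v : V) (w w' : W) : v ⊗ (w + w') = v ⊗ w + v ⊗ w'.
Proof. exact: (linD (@tens_linr V W v)). Qed.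
Lemma tensZl V W c (v : V) (w : W) : (c *: v) ⊗ w = c *: (v ⊗ w).
Proof. exact: (linZ (@tens_linl V W w)). Qed.
Lemma tensZr V W c (v : V) (w : W) : v ⊗ (c *: w) = c *: (v ⊗ w).
Proof. exact: (linZ (@tens_linr V W v)). Qed.
Lemma tens_suml V W I (r : seq I) (P : pred I) (F : I -> V) (w : W) :
  (\sum_(i <- r | P i) F i) ⊗ w = \sum_(i <- r | P i) F i ⊗ w.
Proof. exact: (lin_sum (@tens_linl V W w)). Qed.
Lemma tens_sumr V W I (r : seq I) (P : pred I) (v : V) (F : I -> W) :
  v ⊗ (\sum_(i <- r | P i) F i) = \sum_(i <- r | P i) v ⊗ F i.
Proof. exact: (lin_sum (@tens_linr V W v)). Qed.

Section Lift.
Variables (V W U : lmodType K) (f : V -> W -> U).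

Let ext (r : {malg K[(V * W)%type]}) : U := \sum_(k <- msupp r) r@_k *: f k.1 k.2.

Let tliftE t : tlift f t = ext (lrepr t).
Proof. by rewrite tlift.unlock. Qed.

Let extw (d : {fset (V * W)%type}) r : (msupp r `<=` d)%fset ->
  ext r = \sum_(k <- d) r@_k *: f k.1 k.2.
Proof.
move=> le; rewrite [LHS](big_fset_incl _ le) => //= x xd /mcoeff_outdom ->.
by rewrite scale0r.
Qed.

Let extU v w : ext << (v, w) >> = f v w.
Proof.
by rewrite (extw msuppU_le) big_seq_fset1 mcoeffUU scale1r.
Qed.

Let ext_lin : linear ext.
Proof.
move=> c r s; pose d := (msupp r `|` msupp s `|` msupp (c *: r + s))%fset.
have hr : (msupp r `<=` d)%fset by rewrite /d -fsetUA fsubsetUl.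
have hs : (msupp s `<=` d)%fset by rewrite /d fsetUAC fsubsetUr.
have ht : (msupp (c *: r + s) `<=` d)%fset by rewrite /d fsubsetUr.
rewrite (extw hr) (extw hs) (extw ht) scaler_sumr -big_split /=.
by apply: eq_bigr => k _; rewrite mcoeffD mcoeffZ scalerDl scalerA.
Qed.

Hypothesis bf : bilin f.

Let ext_rel r : tensor_rel r -> ext r = 0.
Proof.
have [fl fr] := bf.
case=> [v v' w|v w w'|c v w|c v w]; rewrite !(linB ext_lin) ?(linZ ext_lin) !extU.
- by rewrite (linD (fl w)) addrAC addrK subrr.
- by rewrite (linD (fr v)) addrAC addrK subrr.
- by rewrite (linZ (fl w)) subrr.
- by rewrite (linZ (fr v)) subrr.
Qed.

Lemma tlift_lin : linear (tlift f).
Proof.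
move=> c s t; rewrite -[s]lreprK -[t]lreprK -lpi_is_linear.
by rewrite !tliftE !(lquot_ext ext_lin ext_rel) ext_lin.
Qed.

Lemma tlift_tens v w : tlift f (v ⊗ w) = f v w.
Proof. by rewrite tliftE tens.unlock (lquot_ext ext_lin ext_rel) extU. Qed.

End Lift.

Lemma tensor_ind V W (P : V ⊗ W -> Prop) :
  P 0 -> (forall s t, P s -> P t -> P (s + t)) ->
  (forall v w, P (v ⊗ w)) -> forall t, P t.
Proof.
move=> P0 PD Pt t; rewrite -[t]lreprK [lrepr t]monalgE (lin_sum (@lpi_is_linear _ _ _)) /=.
elim/big_ind: _ => // -[v w] _.
have -> : << (lrepr t)@_(v, w) *g (v, w) >> =
          (lrepr t)@_(v, w) *: << (v, w) >> :> {malg K[(V * W)%type]}.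
  by apply/malgP => k; rewrite mcoeffZ !mcoeffU mulrnAr mulr1.
by have := Pt ((lrepr t)@_(v, w) *: v) w; rewrite tensZl tens.unlock (linZ (@lpi_is_linear _ _ _)).
Qed.

(* By Zorn's lemma every nonzero vector is sent to 1 by some linear form. *)
Lemma linear_form_exists V (v : V) : v != 0 ->
  exists f : V -> K^o, linear f /\ f v = 1.
Proof.
move=> v0.
pose closed (M : set V) := forall c x y, M x -> M y -> M (c *: x + y).
have [|M [[cM vM] maxM]] := @Zorn_bigcup V (fun M => closed M /\ ~ M v).
  move=> F FP tot; split=> [c x y [X FX Xx] [Y FY Yy]|[X /FP[]//]].
  have [XY|YX] := tot _ _ FX FY.
    by exists Y => //; apply: (FP _ FY).1 => //; apply: XY.
  by exists X => //; apply: (FP _ FX).1 => //; apply: YX.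
have M0 : M 0.
  apply: contrapT => nM0; apply: (maxM [set 0]%classic); last first.
    by split=> [c x y /= -> ->|/= /eqP]; [rewrite scaler0 addr0 | apply/negP].
  split=> [x Mx|/(_ 0 erefl)//]; exfalso; apply: nM0.
  by rewrite -(addNr x) -scaleN1r; apply: cM.
have MZ c x : M x -> M (c *: x) by move=> Mx; rewrite -[_ *: _]addr0; apply: cM.
have MB x y : M x -> M y -> M (x - y).
  by move=> Mx My; rewrite addrC -scaleN1r; apply: cM.
have ex u : exists c, M (u - c *: v).
  have [Mu|nMu] := pselect (M u); first by exists 0; rewrite scale0r subr0.
  pose B : set V := fun w => exists c, M (w - c *: u).
  have [c Mc] : B v.
    apply: contrapT => nBv; apply: (maxM B); last first.
      split=> // c x y [a Ma] [b Mb]; exists (c * a + b).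
      have -> : c *: x + y - (c * a + b) *: u = c *: (x - a *: u) + (y - b *: u).
        by rewrite scalerBr scalerA scalerDl opprD addrACA.
      exact: cM.
    split=> [x Mx|BM]; first by exists 0; rewrite scale0r subr0.
    by apply: nMu; apply: BM; exists 1; rewrite scale1r subrr.
  have c0 : c != 0.
    by apply/eqP => c0; apply: vM; move: Mc; rewrite c0 scale0r subr0.
  exists c^-1; have -> : u - c^-1 *: v = - c^-1 *: (v - c *: u).
    by rewrite scalerBr scalerA mulNr mulVf // !scaleNr scale1r opprK addrC.
  exact: MZ.
have uniq a b u : M (u - a *: v) -> M (u - b *: v) -> a = b.
  move=> Ma Mb; apply/eqP; rewrite -subr_eq0; apply/negPn/negP => ab.
  apply: vM; have := MZ (a - b)^-1 _ (MB _ _ Mb Ma).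
  by rewrite opprB [in X in M X](addrC (u - _)) subrKA -scalerBl scalerA mulVf // scale1r.
pose f u : K^o := projT1 (cid (ex u)).
have fP u : M (u - f u *: v) by apply: (projT2 (cid (ex u))).
exists f; split=> [c x y|].
  apply: (uniq _ _ (c *: x + y)); first exact: fP.
  have -> : c *: x + y - (c *: f x + f y) *: v
            = c *: (x - f x *: v) + (y - f y *: v).
    by rewrite scalerBr scalerA scalerDl opprD addrACA.
  by apply: cM; apply: fP.
by apply: (uniq _ _ v); [exact: fP | rewrite scale1r subrr].
Qed.

Lemma tens_neq0 V W (v : V) (w : W) : v != 0 -> w != 0 -> v ⊗ w != 0.
Proof.
move=> /linear_form_exists[f [lf fv]] /linear_form_exists[g [lg gw]].
have bfg : bilin (fun a b => f a * g b : K^o).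
  split=> [b c x y|a c x y].
    by rewrite lf mulrDl scalerAl.
  by rewrite lg mulrDr scalerAr.
apply/eqP => /(congr1 (tlift (fun a b => f a * g b : K^o))).
rewrite (tlift_tens bfg) (lin0 (tlift_lin bfg)) fv gw mulr1 => /eqP.
by rewrite oner_eq0.
Qed.

End TensorTheory.

Definition Z22 : Type := ('Z_2 * 'Z_2)%type.
HB.instance Definition _ := GRing.Zmodule.on Z22.
HB.instance Definition _ := Finite.on Z22.

Definition Z22pair (d e : Z22) : 'Z_2 := d.1 * e.1 + d.2 * e.2.

Definition Z22sign (K : fieldType) (d e : Z22) : K := (-1) ^+ (Z22pair d e : nat).

Lemma sign_Z2D (K : fieldType) (a b : 'Z_2) :
  (-1 : K) ^+ ((a + b)%R : nat) = (-1) ^+ (a : nat) * (-1) ^+ (b : nat).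
Proof. by rewrite -exprD /= modn2 signr_odd. Qed.

Lemma Z22signDl (K : fieldType) d d' e :
  Z22sign K (d + d') e = Z22sign K d e * Z22sign K d' e.
Proof.
rewrite /Z22sign; have -> : Z22pair (d + d') e = Z22pair d e + Z22pair d' e by rewrite /Z22pair !mulrDl addrACA.
exact: sign_Z2D.
Qed.

Lemma Z22signDr (K : fieldType) d e e' :
  Z22sign K d (e + e') = Z22sign K d e * Z22sign K d e'.
Proof.
rewrite /Z22sign; have -> : Z22pair d (e + e') = Z22pair d e + Z22pair d e' by rewrite /Z22pair !mulrDr addrACA.
exact: sign_Z2D.
Qed.

Lemma Z22sign0l (K : fieldType) e : Z22sign K 0 e = 1.
Proof. by rewrite /Z22sign /Z22pair !mul0r addr0. Qed.
Lemma Z22sign0r (K : fieldType) e : Z22sign K e 0 = 1.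
Proof. by rewrite /Z22sign /Z22pair !mulr0 addr0. Qed.

(* A grading is given by the projections [hcomp d] on its homogeneous
   components: the component of degree [d] is the image of [hcomp d], and the
   axioms say that the space is the direct sum of these images. *)
HB.mixin Record isZ22Graded (K : fieldType) V of GRing.Lmodule K V := {
  hcomp : Z22 -> V -> V;
  hcomp_lin : forall d, linear (hcomp d);
  hcompK : forall d e v, hcomp d (hcomp e v) = if d == e then hcomp e v else 0;
  hcomp_sum : forall v, \sum_d hcomp d v = v
}.

#[short(type="z22LmodType")]
HB.structure Definition Z22Lmodule (K : fieldType) :=
  {V of GRing.Lmodule K V & isZ22Graded K V}.

Definition homog (K : fieldType) (V : z22LmodType K) (d : Z22) (v : V) : Prop :=
  hcomp d v = v.

HB.mixin Record isZ22Algebra (K : fieldType) A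
    of GRing.Algebra K A & Z22Lmodule K A := {
  homog1 : homog 0 (1 : A);
  homogM : forall d e (a b : A), homog d a -> homog e b -> homog (d + e) (a * b)
}.

#[short(type="z22AlgType")]
HB.structure Definition Z22Algebra (K : fieldType) :=
  {A of GRing.Algebra K A & Z22Lmodule K A & isZ22Algebra K A}.

Arguments homog1 {K} A : rename.
Arguments homogM {K A d e a b} _ _ : rename.

Section GradedTheory.
Variables (K : fieldType) (V : z22LmodType K).

Lemma homog_hcomp d (v : V) : homog d (hcomp d v).
Proof. by rewrite /homog hcompK eqxx. Qed.

Lemma hcomp_homog d e (v : V) : homog e v -> hcomp d v = if d == e then v else 0.
Proof. by move=> hv; rewrite -hv hcompK. Qed.

End GradedTheory.

Section BaseField.
Variable K : fieldType.

Definition triv_hcomp (d : Z22) (c : K^o) : K^o := if d == 0 then c else 0.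

Lemma triv_hcomp_lin d : linear (triv_hcomp d).
Proof. by move=> c u v; rewrite /triv_hcomp; case: eqP => // _; rewrite scaler0 addr0. Qed.
Lemma triv_hcompK d e v :
  triv_hcomp d (triv_hcomp e v) = if d == e then triv_hcomp e v else 0.
Proof.
rewrite /triv_hcomp; have [->|ne] := eqVneq d e.
  by case: (e == 0).
by case: eqP => // d0; case: eqP => // e0; rewrite d0 e0 eqxx in ne.
Qed.
Lemma triv_hcomp_sum v : \sum_d triv_hcomp d v = v.
Proof.
rewrite (bigD1 0) //= big1 ?addr0 /triv_hcomp ?eqxx // => i /negPf.
by move=> ->.
Qed.

HB.instance Definition _ := isZ22Graded.Build K K^o
  triv_hcomp_lin triv_hcompK triv_hcomp_sum.

Lemma triv_homog1 : homog 0 (1 : K^o).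
Proof. by []. Qed.
Lemma triv_homogM d e (a b : K^o) :
  homog d a -> homog e b -> homog (d + e) (a * b).
Proof.
rewrite /homog /hcomp /= /triv_hcomp.
have [->|_ <-] := eqVneq d 0; last by rewrite mul0r if_same.
have [->|_ _ <-] := eqVneq e 0; last by rewrite mulr0 if_same.
by rewrite addr0 eqxx.
Qed.

HB.instance Definition _ := isZ22Algebra.Build K K^o
  triv_homog1 triv_homogM.
End BaseField.

HB.lock Definition tensor_hcomp (K : fieldType) (V W : z22LmodType K)
    (d : Z22) (t : V ⊗ W) : V ⊗ W :=
  tlift (fun v w => \sum_i hcomp i v ⊗ hcomp (d - i) w) t.

Section TensorGraded.
Variables (K : fieldType) (V W : z22LmodType K).
Local Notation tensor_hcomp := (@tensor_hcomp K V W).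

Lemma tensor_hcomp_bilin d :
  bilin (fun (v : V) (w : W) => \sum_i hcomp i v ⊗ hcomp (d - i) w).
Proof.
split=> [w c v v'|v c w w']; rewrite scaler_sumr -big_split /=;
  apply: eq_bigr => i _.
  by rewrite hcomp_lin tens_linl.
by rewrite hcomp_lin tens_linr.
Qed.

Lemma tensor_hcomp_lin d : linear (tensor_hcomp d).
Proof. by rewrite tensor_hcomp.unlock => c s t; apply/tlift_lin/tensor_hcomp_bilin. Qed.

Lemma tensor_hcomp_tens d i j (v : V) (w : W) : homog i v -> homog j w ->
  tensor_hcomp d (v ⊗ w) = if d == i + j then v ⊗ w else 0.
Proof.
move=> hv hw; rewrite tensor_hcomp.unlock (tlift_tens (tensor_hcomp_bilin d)).
rewrite (bigD1 i) //= big1 ?addr0 => [|k /negPf ki]; last first.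
  by rewrite (hcomp_homog _ hv) ki tens0l.
rewrite hv (hcomp_homog _ hw) subr_eq (addrC j i).
by case: ifP => //; rewrite tens0r.
Qed.

Lemma tensor_ind_homog (P : V ⊗ W -> Prop) :
  P 0 -> (forall s t, P s -> P t -> P (s + t)) ->
  (forall i j (v : V) (w : W), homog i v -> homog j w -> P (v ⊗ w)) ->
  forall t, P t.
Proof.
move=> P0 PD Pt; elim/tensor_ind => // v w.
rewrite -[v]hcomp_sum -[w]hcomp_sum tens_suml.
apply: (big_ind P) => // i _; rewrite tens_sumr.
apply: (big_ind P) => // j _.
by apply: (Pt i j); apply: homog_hcomp.
Qed.

Lemma tensor_hcompK d e t :
  tensor_hcomp d (tensor_hcomp e t) = if d == e then tensor_hcomp e t else 0.
Proof.
elim/tensor_ind_homog: t => [|s t hs ht|i j v w hv hw].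
- by rewrite !(lin0 (tensor_hcomp_lin _)) if_same.
- rewrite !(linD (tensor_hcomp_lin e)) (linD (tensor_hcomp_lin d)) hs ht.
  by case: ifP => // _; rewrite addr0.
- rewrite (tensor_hcomp_tens e hv hw).
  have [->|ne] := eqVneq e (i + j).
    by rewrite (tensor_hcomp_tens d hv hw).
  by rewrite (lin0 (tensor_hcomp_lin _)) if_same.
Qed.

Lemma tensor_hcomp_sum t : \sum_d tensor_hcomp d t = t.
Proof.
elim/tensor_ind_homog: t => [|s t hs ht|i j v w hv hw].
- by rewrite big1 // => d _; rewrite (lin0 (tensor_hcomp_lin _)).
- rewrite -[in RHS]hs -[in RHS]ht -big_split /=.
  by apply: eq_bigr => d _; rewrite (linD (tensor_hcomp_lin _)).
- rewrite (bigD1 (i + j)) //= big1 ?addr0 => [|k /negPf ki].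
    by rewrite (tensor_hcomp_tens _ hv hw) eqxx.
  by rewrite (tensor_hcomp_tens _ hv hw) ki.
Qed.

HB.instance Definition _ := isZ22Graded.Build K (V ⊗ W)%type
  tensor_hcomp_lin tensor_hcompK tensor_hcomp_sum.

End TensorGraded.

(* For homogeneous [b] and [c] this is [Z22sign (deg b) (deg c) *: (ac ⊗ bd)];
   see [tensor_mul_tens]. *)
HB.lock Definition tensor_mul2 (K : fieldType) (A B : z22AlgType K)
    (a : A) (b : B) (c : A) (d : B) : A ⊗ B :=
  \sum_i \sum_j Z22sign K i j *: ((a * hcomp j c) ⊗ (hcomp i b * d)).

HB.lock Definition tensor_mul (K : fieldType) (A B : z22AlgType K)
    (s t : A ⊗ B) : A ⊗ B :=
  tlift (fun a b => tlift (tensor_mul2 a b) t) s.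

Section TensorAlgebra.
Variables (K : fieldType) (A B : z22AlgType K).
Local Notation tensor_mul2 := (@tensor_mul2 K A B).
Local Notation tensor_mul := (@tensor_mul K A B).

Lemma mul_bilin (C : z22AlgType K) : bilin (fun a b : C => a * b).
Proof.
split=> [w c v v'|v c w w'] /=; first by rewrite mulrDl scalerAl.
by rewrite mulrDr scalerAr.
Qed.

Lemma tensor_mul2_bilin_r a b : bilin (tensor_mul2 a b).
Proof.
rewrite tensor_mul2.unlock.
split=> [w c v v'|v c w w']; rewrite scaler_sumr -big_split /=;
  apply: eq_bigr => i _; rewrite scaler_sumr -big_split /=;
  apply: eq_bigr => j _; rewrite scalerA mulrC -scalerA -scalerDr; congr (_ *: _).
  by rewrite hcomp_lin (mul_bilin A).2 tens_linl.
by rewrite (mul_bilin B).2 tens_linr.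
Qed.

Lemma tensor_mul2_bilin_l c d : bilin (fun a b => tensor_mul2 a b c d).
Proof.
rewrite tensor_mul2.unlock.
split=> [w k v v'|v k w w']; rewrite scaler_sumr -big_split /=;
  apply: eq_bigr => i _; rewrite scaler_sumr -big_split /=;
  apply: eq_bigr => j _; rewrite scalerA mulrC -scalerA -scalerDr; congr (_ *: _).
  by rewrite (mul_bilin A).1 tens_linl.
by rewrite hcomp_lin (mul_bilin B).1 tens_linr.
Qed.

Lemma tensor_mul_bilin_aux t : bilin (fun a b => tlift (tensor_mul2 a b) t).
Proof.
split=> [w k v v'|v k w w'].
  elim/tensor_ind: t => [|s t hs ht|c d].
  - by rewrite !(lin0 (tlift_lin (tensor_mul2_bilin_r _ _))) scaler0 addr0.
  - rewrite !(linD (tlift_lin (tensor_mul2_bilin_r _ _))) hs ht scalerDr.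
    exact: addrACA.
  - rewrite !(tlift_tens (tensor_mul2_bilin_r _ _)).
    exact: (tensor_mul2_bilin_l c d).1.
elim/tensor_ind: t => [|s t hs ht|c d].
- by rewrite !(lin0 (tlift_lin (tensor_mul2_bilin_r _ _))) scaler0 addr0.
- rewrite !(linD (tlift_lin (tensor_mul2_bilin_r _ _))) hs ht scalerDr.
  exact: addrACA.
- rewrite !(tlift_tens (tensor_mul2_bilin_r _ _)).
  exact: (tensor_mul2_bilin_l c d).2.
Qed.

Lemma tensor_mul_linl t : linear (tensor_mul^~ t).
Proof. by rewrite tensor_mul.unlock => c s s'; apply/tlift_lin/tensor_mul_bilin_aux. Qed.

Lemma tensor_mul_linr s : linear (tensor_mul s).
Proof.
move=> k t t'; elim/tensor_ind: s => [|s s' hs hs'|a b].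
- by rewrite !(lin0 (tensor_mul_linl _)) scaler0 addr0.
- rewrite !(linD (tensor_mul_linl _)) hs hs' scalerDr.
  exact: addrACA.
- rewrite tensor_mul.unlock !(tlift_tens (tensor_mul_bilin_aux _)).
  exact: (tlift_lin (tensor_mul2_bilin_r a b)).
Qed.

Lemma tensor_mul_tens i j (a : A) (b : B) (c : A) (d : B) :
  homog i b -> homog j c ->
  tensor_mul (a ⊗ b) (c ⊗ d) = Z22sign K i j *: ((a * c) ⊗ (b * d)).
Proof.
move=> hb hc; rewrite tensor_mul.unlock (tlift_tens (tensor_mul_bilin_aux _)).
rewrite (tlift_tens (tensor_mul2_bilin_r _ _)) tensor_mul2.unlock.
rewrite (bigD1 i) //= [X in _ + X]big1 ?addr0 => [|k /negPf ki]; last first.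
  by rewrite big1 // => l _; rewrite (hcomp_homog _ hb) ki mul0r tens0r scaler0.
rewrite (bigD1 j) //= [X in _ + X]big1 ?addr0 => [|k /negPf ki]; last first.
  by rewrite (hcomp_homog _ hc) ki mulr0 tens0l scaler0.
by rewrite hb hc.
Qed.

Lemma tensor_mulA : associative tensor_mul.
Proof.
move=> r s t.
elim/tensor_ind_homog: r => [|r r' hr hr'|i1 i2 a b ha hb].
- by rewrite !(lin0 (tensor_mul_linl _)).
- by rewrite !(linD (tensor_mul_linl _)) hr hr'.
elim/tensor_ind_homog: s => [|r r' hr hr'|j1 j2 c d hc hd].
- by rewrite !(lin0 (tensor_mul_linl _), lin0 (tensor_mul_linr _)).
- by rewrite !(linD (tensor_mul_linl _), linD (tensor_mul_linr _)) hr hr'.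
elim/tensor_ind_homog: t => [|r r' hr hr'|k1 k2 e f he hf].
- by rewrite !(lin0 (tensor_mul_linr _)).
- by rewrite !(linD (tensor_mul_linr _)) hr hr'.
rewrite (tensor_mul_tens _ _ hd he) (linZ (tensor_mul_linr _)).
rewrite (tensor_mul_tens _ _ hb (homogM hc he)).
rewrite (tensor_mul_tens _ _ hb hc) (linZ (tensor_mul_linl _)).
rewrite (tensor_mul_tens _ _ (homogM hb hd) he).
rewrite !scalerA !mulrA Z22signDl Z22signDr.
by rewrite [Z22sign K j2 k1 * _]mulrC mulrA.
Qed.

Lemma tensor_mul1 : left_id (1 ⊗ 1) tensor_mul.
Proof.
elim/tensor_ind_homog => [|s t hs ht|i j a b ha hb].
- by rewrite (lin0 (tensor_mul_linr _)).
- by rewrite (linD (tensor_mul_linr _)) hs ht.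
- by rewrite (tensor_mul_tens _ _ (homog1 B) ha) Z22sign0l scale1r !mul1r.
Qed.

Lemma tensor_mulr1 : right_id (1 ⊗ 1) tensor_mul.
Proof.
elim/tensor_ind_homog => [|s t hs ht|i j a b ha hb].
- by rewrite (lin0 (tensor_mul_linl _)).
- by rewrite (linD (tensor_mul_linl _)) hs ht.
- by rewrite (tensor_mul_tens _ _ hb (homog1 A)) Z22sign0r scale1r !mulr1.
Qed.

Lemma tensor_mulDl : left_distributive tensor_mul +%R.
Proof. by move=> r s t; rewrite (linD (tensor_mul_linl _)). Qed.
Lemma tensor_mulDr : right_distributive tensor_mul +%R.
Proof. by move=> r s t; rewrite (linD (tensor_mul_linr _)). Qed.

HB.instance Definition _ := GRing.Zmodule_isPzRing.Build (A ⊗ B)%type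
  tensor_mulA tensor_mul1 tensor_mulr1 tensor_mulDl tensor_mulDr.
HB.instance Definition _ := GRing.PzSemiRing_isNonZero.Build (A ⊗ B)%type
  (tens_neq0 (oner_neq0 A) (oner_neq0 B)).

Lemma tensor_scalerAl (c : K) (s t : A ⊗ B) : c *: (s * t) = (c *: s) * t.
Proof. by rewrite [RHS](linZ (tensor_mul_linl _)). Qed.
Lemma tensor_scalerAr (c : K) (s t : A ⊗ B) : c *: (s * t) = s * (c *: t).
Proof. by rewrite [RHS](linZ (tensor_mul_linr _)). Qed.

HB.instance Definition _ := GRing.Lmodule_isLalgebra.Build K (A ⊗ B)%type
  tensor_scalerAl.
HB.instance Definition _ := GRing.Lalgebra_isAlgebra.Build K (A ⊗ B)%type
  tensor_scalerAr.

Lemma homog_tens i j (a : A) (b : B) :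
  homog i a -> homog j b -> homog (i + j) (a ⊗ b).
Proof.
by move=> ha hb; rewrite /homog [LHS](tensor_hcomp_tens _ ha hb) eqxx.
Qed.

Lemma tensor_homog1 : homog 0 (1 : A ⊗ B).
Proof. by rewrite -[0]addr0; apply: homog_tens; apply: homog1. Qed.

Lemma tensor_homogM d e (s t : A ⊗ B) :
  homog d s -> homog e t -> homog (d + e) (s * t).
Proof.
have hc0 f : hcomp f (0 : A ⊗ B) = 0 by apply: (lin0 (hcomp_lin f)).
suff H : homog (d + e) (hcomp d s * hcomp e t).
  by rewrite {1}/homog => hs; rewrite {1}/homog => ht; rewrite hs ht in H.
elim/tensor_ind_homog: s => [|s s' hs hs'|i1 i2 a b ha hb].
- by rewrite hc0 mul0r /homog hc0.
- by rewrite (linD (hcomp_lin d)) mulrDl /homog (linD (hcomp_lin _)) hs hs'.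
elim/tensor_ind_homog: t => [|s s' hs hs'|j1 j2 a' b' ha' hb'].
- by rewrite hc0 mulr0 /homog hc0.
- by rewrite (linD (hcomp_lin e)) mulrDr /homog (linD (hcomp_lin _)) hs hs'.
rewrite (hcomp_homog _ (homog_tens ha hb)).
case: eqP => [->|_]; last by rewrite mul0r /homog hc0.
rewrite (hcomp_homog _ (homog_tens ha' hb')).
case: eqP => [->|_]; last by rewrite mulr0 /homog hc0.
rewrite -[_ * _]/(tensor_mul _ _) (tensor_mul_tens _ _ hb ha').
rewrite /homog (linZ (hcomp_lin _)) addrACA; congr (_ *: _).
by apply: homog_tens; apply: homogM.
Qed.

HB.instance Definition _ := isZ22Algebra.Build K (A ⊗ B)%type
  tensor_homog1 tensor_homogM.

End TensorAlgebra.

Section TensorMaps.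
Variable K : fieldType.

Definition tmap (V W V' W' : lmodType K) (f : V -> V') (g : W -> W') :
  (V ⊗ W)%type -> (V' ⊗ W')%type := tlift (fun v w => f v ⊗ g w).

Definition tassoc (U V W : lmodType K) :
    ((U ⊗ V)%type ⊗ W)%type -> (U ⊗ (V ⊗ W)%type)%type :=
  tlift (fun t w => tlift (fun u v => u ⊗ (v ⊗ w)) t).

Definition lunit (V : lmodType K) : (K^o ⊗ V)%type -> V :=
  tlift (fun (c : K^o) (v : V) => (c : K) *: v).
Definition runit (V : lmodType K) : (V ⊗ K^o)%type -> V :=
  tlift (fun (v : V) (c : K^o) => (c : K) *: v).

End TensorMaps.

Section Bialgebra.
Variable K : fieldType.

Record Z22coalgebra (C : z22LmodType K) (Delta : C -> C ⊗ C) (eps : C -> K^o) :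
    Prop := {
  coprod_linear : linear Delta;
  counit_linear : linear eps;
  coprod_homog : forall d c, homog d c -> homog d (Delta c);
  counit_homog : forall d c, homog d c -> homog d (eps c);
  coprod_assoc : forall c,
    tassoc (tmap Delta id (Delta c)) = tmap id Delta (Delta c);
  counit_l : forall c, lunit (tmap eps id (Delta c)) = c;
  counit_r : forall c, runit (tmap id eps (Delta c)) = c
}.

Definition unital_alg_morphism (A B : z22AlgType K) (f : A -> B) : Prop :=
  linear f /\ monoid_morphism f.

Record Z22bialgebra (A : z22AlgType K) (Delta : A -> A ⊗ A) (eps : A -> K^o) :
    Prop := {
  bialg_coalgebra : Z22coalgebra Delta eps;
  coprod_morphism : unital_alg_morphism Delta;
  counit_morphism : unital_alg_morphism eps
}.

End Bialgebra.

Section AlgebraQuotient.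
Variables (K : fieldType) (A : z22AlgType K) (S : A -> Prop).

(* The two-sided ideal generated by [S] is the linear span of [ideal_gen]. *)
Definition ideal_gen (v : A) : Prop := exists a r b, S r /\ v = a * r * b.

Definition relations_homog : Prop := forall r, S r -> exists d, homog d r.

Definition relations_proper : Prop := ~ span ideal_gen 1.

(* The quotient algebra; the two proofs are only needed to equip it with its
   grading and its (nontrivial) ring structure. *)
Definition aquot (hS : relations_homog) (h1 : relations_proper) : Type :=
  lquot ideal_gen.

End AlgebraQuotient.

HB.lock Definition api (K : fieldType) (A : z22AlgType K) (S : A -> Prop)
  (hS : relations_homog S) (h1 : relations_proper S) (a : A) : aquot hS h1 :=
  lpi (ideal_gen S) a.
HB.lock Definition arepr (K : fieldType) (A : z22AlgType K) (S : A -> Prop)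
  (hS : relations_homog S) (h1 : relations_proper S) (u : aquot hS h1) : A :=
  @lrepr K A (ideal_gen S) u.
HB.lock Definition aquot_mul (K : fieldType) (A : z22AlgType K) (S : A -> Prop)
  (hS : relations_homog S) (h1 : relations_proper S) (u v : aquot hS h1) :
  aquot hS h1 := api hS h1 (arepr u * arepr v).
HB.lock Definition aquot_hcomp (K : fieldType) (A : z22AlgType K)
  (S : A -> Prop) (hS : relations_homog S) (h1 : relations_proper S)
  (d : Z22) (u : aquot hS h1) : aquot hS h1 :=
  api hS h1 (hcomp d (arepr u)).

Section AlgebraQuotientTheory.
Variables (K : fieldType) (A : z22AlgType K) (S : A -> Prop).
Variables (hS : relations_homog S) (h1 : relations_proper S).
Local Notation Q := (aquot hS h1).
Local Notation ideal_gen := (ideal_gen S).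
Local Notation api := (api hS h1).
Local Notation rep := (@arepr K A S hS h1).
Local Notation aquot_mul := (@aquot_mul K A S hS h1).
Local Notation aquot_hcomp := (@aquot_hcomp K A S hS h1).

HB.instance Definition _ := GRing.Lmodule.on Q.

Lemma areprK (u : Q) : api (rep u) = u.
Proof. by rewrite api.unlock arepr.unlock; apply: lreprK. Qed.

Lemma api_eq a b : api a = api b <-> span ideal_gen (a - b).
Proof. by rewrite api.unlock; apply: lpi_eq. Qed.

Lemma rep_api a : span ideal_gen (rep (api a) - a).
Proof. by apply/api_eq; rewrite areprK. Qed.

Lemma api_lin : linear api.
Proof. by rewrite api.unlock; apply: lpi_is_linear. Qed.

Let ideal_mull c v : span ideal_gen v -> span ideal_gen (c * v).
Proof.
elim=> [w [a [r [b [Sr ->]]]]||w w' _ h _ h'|k w _ h].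
- by apply: span_gen; exists (c * a), r, b; rewrite !mulrA.
- by rewrite mulr0; apply: span_zero.
- by rewrite mulrDr; apply: span_add.
- by rewrite -scalerAr; apply: span_scale.
Qed.

Let ideal_mulr c v : span ideal_gen v -> span ideal_gen (v * c).
Proof.
elim=> [w [a [r [b [Sr ->]]]]||w w' _ h _ h'|k w _ h].
- by apply: span_gen; exists a, r, (b * c); rewrite !mulrA.
- by rewrite mul0r; apply: span_zero.
- by rewrite mulrDl; apply: span_add.
- by rewrite -scalerAl; apply: span_scale.
Qed.

Lemma api_mul a b : aquot_mul (api a) (api b) = api (a * b).
Proof.
rewrite aquot_mul.unlock; apply/api_eq; set a' := rep _; set b' := rep _.
have -> : a' * b' - a * b = a' * (b' - b) + (a' - a) * b.
  by rewrite mulrBr mulrBl addrA subrK.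
by apply: span_add; [apply/ideal_mull/rep_api | apply/ideal_mulr/rep_api].
Qed.

Lemma aquot_mulA : associative aquot_mul.
Proof.
by move=> u v w; rewrite -[u]areprK -[v]areprK -[w]areprK !api_mul mulrA.
Qed.
Lemma aquot_mul1 : left_id (api 1) aquot_mul.
Proof. by move=> u; rewrite -[u]areprK api_mul mul1r. Qed.
Lemma aquot_mulr1 : right_id (api 1) aquot_mul.
Proof. by move=> u; rewrite -[u]areprK api_mul mulr1. Qed.
Lemma aquot_mulDl : left_distributive aquot_mul +%R.
Proof.
move=> u v w; rewrite -[u]areprK -[v]areprK -[w]areprK.
by rewrite -(linD api_lin) !api_mul mulrDl (linD api_lin).
Qed.
Lemma aquot_mulDr : right_distributive aquot_mul +%R.
Proof.
move=> u v w; rewrite -[u]areprK -[v]areprK -[w]areprK.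
by rewrite -(linD api_lin) !api_mul mulrDr (linD api_lin).
Qed.

HB.instance Definition _ := GRing.Zmodule_isPzRing.Build Q
  aquot_mulA aquot_mul1 aquot_mulr1 aquot_mulDl aquot_mulDr.

Lemma aquot_oner_neq0 : (1 : Q) != 0.
Proof.
apply/eqP; rewrite -[0 in RHS](lin0 api_lin) => /api_eq.
by rewrite subr0; apply: h1.
Qed.
HB.instance Definition _ := GRing.PzSemiRing_isNonZero.Build Q aquot_oner_neq0.

Lemma hcomp_ideal d v : span ideal_gen v -> span ideal_gen (hcomp d v).
Proof.
elim=> [w [a [r [b [Sr ->]]]]||w w' _ h _ h'|k w _ h]; first last.
- by rewrite (linZ (hcomp_lin d)); apply: span_scale.
- by rewrite (linD (hcomp_lin d)); apply: span_add.
- by rewrite (lin0 (hcomp_lin d)); apply: span_zero.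
have [e hr] := hS Sr; rewrite -[a]hcomp_sum -[b]hcomp_sum.
rewrite -mulrA mulr_suml (lin_sum (hcomp_lin d)).
apply: big_ind => [||i _]; [exact: span_zero | exact: span_add |].
rewrite !mulr_sumr (lin_sum (hcomp_lin d)).
apply: big_ind => [||j _]; [exact: span_zero | exact: span_add |].
have h := homogM (homog_hcomp i a) (homogM hr (homog_hcomp j b)).
rewrite (hcomp_homog _ h); case: ifP => _; last exact: span_zero.
by apply: span_gen; exists (hcomp i a), r, (hcomp j b); rewrite mulrA.
Qed.

Lemma aquot_hcompE d a : aquot_hcomp d (api a) = api (hcomp d a).
Proof.
rewrite aquot_hcomp.unlock; apply/api_eq; set a' := rep _.
have -> : hcomp d a' - hcomp d a = hcomp d (a' - a).
  by rewrite (linD (hcomp_lin d)) -!scaleN1r (linZ (hcomp_lin d)).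
exact/hcomp_ideal/rep_api.
Qed.

Lemma aquot_hcomp_lin d : linear (aquot_hcomp d).
Proof.
move=> c u v; rewrite -[u]areprK -[v]areprK -api_lin.
by rewrite !aquot_hcompE hcomp_lin api_lin.
Qed.
Lemma aquot_hcompK d e u :
  aquot_hcomp d (aquot_hcomp e u) = if d == e then aquot_hcomp e u else 0.
Proof.
rewrite -[u]areprK !aquot_hcompE hcompK; case: ifP => // _.
exact: (lin0 api_lin).
Qed.
Lemma aquot_hcomp_sum u : \sum_d aquot_hcomp d u = u.
Proof.
rewrite -[u in RHS]areprK -[rep u in RHS]hcomp_sum (lin_sum api_lin).
by apply: eq_bigr => d _; rewrite aquot_hcomp.unlock.
Qed.

HB.instance Definition _ := isZ22Graded.Build K Q
  aquot_hcomp_lin aquot_hcompK aquot_hcomp_sum.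

Lemma aquot_scalerAl (c : K) (u v : Q) : c *: (u * v) = (c *: u) * v.
Proof.
rewrite -[u]areprK -[v]areprK -(linZ api_lin) -![_ * _]/(aquot_mul _ _) !api_mul.
by rewrite -(linZ api_lin) scalerAl.
Qed.
Lemma aquot_scalerAr (c : K) (u v : Q) : c *: (u * v) = u * (c *: v).
Proof.
rewrite -[u]areprK -[v]areprK -(linZ api_lin) -![_ * _]/(aquot_mul _ _) !api_mul.
by rewrite -(linZ api_lin) scalerAr.
Qed.
HB.instance Definition _ := GRing.Lmodule_isLalgebra.Build K Q aquot_scalerAl.
HB.instance Definition _ := GRing.Lalgebra_isAlgebra.Build K Q aquot_scalerAr.

Lemma aquot_homog1 : homog 0 (1 : Q).
Proof. by rewrite /homog [LHS]aquot_hcompE (homog1 A). Qed.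
Lemma aquot_homogM d e (u v : Q) :
  homog d u -> homog e v -> homog (d + e) (u * v).
Proof.
rewrite /homog => <- <-; rewrite -[u]areprK -[v]areprK.
rewrite -[hcomp d _]/(aquot_hcomp d _) -[hcomp e _]/(aquot_hcomp e _).
rewrite !aquot_hcompE -[_ * _]/(aquot_mul _ _) api_mul.
rewrite -[LHS]/(aquot_hcomp _ _) aquot_hcompE; congr api.
by apply: homogM; apply: homog_hcomp.
Qed.

HB.instance Definition _ := isZ22Algebra.Build K Q
  aquot_homog1 aquot_homogM.

End AlgebraQuotientTheory.

Variant gen := Gx | Gxi | Gtheta | Gz.

Definition gen_code (g : gen) : nat :=
  match g with Gx => 0 | Gxi => 1 | Gtheta => 2 | Gz => 3 end.
Definition gen_decode (n : nat) : option gen := nth None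
  [:: Some Gx; Some Gxi; Some Gtheta; Some Gz] n.
Lemma gen_codeK : pcancel gen_code gen_decode. Proof. by case. Qed.
HB.instance Definition _ := Choice.copy gen (pcan_type gen_codeK).

Definition gdeg (g : gen) : Z22 :=
  match g with
  | Gx => (0, 0) | Gxi => (0, 1) | Gtheta => (1, 0) | Gz => (1, 1)
  end.

Definition wdeg (w : {fmonom gen}) : Z22 := \sum_(g <- (w : seq gen)) gdeg g.

Definition freeAlg (K : fieldType) : Type := {malg K[{fmonom gen}]}.
HB.instance Definition _ (K : fieldType) := GRing.Lalgebra.on (freeAlg K).

HB.lock Definition free_hcomp (K : fieldType) (d : Z22) (f : freeAlg K) :
  freeAlg K := \sum_(w <- msupp f | wdeg w == d) << f@_w *g w >>.

Section FreeAlgebra.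
Variable K : fieldType.
Local Notation freeAlg := (freeAlg K).
Local Notation free_hcomp := (@free_hcomp K).

Lemma free_hcomp_coeff d (f : freeAlg) w :
  (free_hcomp d f)@_w = if wdeg w == d then f@_w else 0.
Proof.
rewrite free_hcomp.unlock big_mkcond raddf_sum /=.
have [wf|wf] := boolP (w \in msupp f); last first.
  rewrite (mcoeff_outdom wf) if_same big1_fset // => w' w'f _.
  case: ifP => _; rewrite ?mcoeff0 // mcoeffU.
  by case: eqP w'f wf => // -> ->.
rewrite (big_fsetD1 w) //= big1_fset ?addr0 => [|w'].
  by case: ifP => _; rewrite ?mcoeff0 ?mcoeffUU.
rewrite in_fsetD1 => /andP[/negPf ne _] _.
by case: ifP => _; rewrite ?mcoeff0 // mcoeffU ne.
Qed.

Lemma free_hcomp_lin d : linear (free_hcomp d).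
Proof.
move=> c f g; apply/malgP => w.
rewrite mcoeffD mcoeffZ !free_hcomp_coeff mcoeffD mcoeffZ.
by case: ifP => // _; rewrite mulr0 addr0.
Qed.
Lemma free_hcompK d e f :
  free_hcomp d (free_hcomp e f) = if d == e then free_hcomp e f else 0.
Proof.
apply/malgP => w; rewrite !free_hcomp_coeff.
have [->|ne] := eqVneq d e.
  by rewrite free_hcomp_coeff; case: (wdeg w == e).
by rewrite mcoeff0; case: eqP => // ->; rewrite (negPf ne).
Qed.
Lemma free_hcomp_sum f : \sum_d free_hcomp d f = f.
Proof.
apply/malgP => w; rewrite raddf_sum (bigD1 (wdeg w)) //= big1 ?addr0.
  by rewrite free_hcomp_coeff eqxx.
by move=> d /negPf ne; rewrite free_hcomp_coeff eq_sym ne.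
Qed.

HB.instance Definition _ := isZ22Graded.Build K freeAlg
  free_hcomp_lin free_hcompK free_hcomp_sum.

Lemma malgUU_mul (c c' : K) (w w' : {fmonom gen}) :
  (<< c *g w >> : freeAlg) * << c' *g w' >> = << c * c' *g mmul w w' >>.
Proof. exact: fgmulUU. Qed.

Lemma free_scalerAr (c : K) (f g : freeAlg) : c *: (f * g) = f * (c *: g).
Proof.
rewrite [f]monalgE [g]monalgE mulr_suml !scaler_sumr mulr_suml.
apply: eq_bigr => w _; rewrite !mulr_sumr scaler_sumr; apply: eq_bigr => w' _.
have cU (a : K) (v : {fmonom gen}) : c *: (<< a *g v >> : freeAlg) = << c * a *g v >>.
  by apply/malgP => k; rewrite mcoeffZ !mcoeffU mulrnAr.
by rewrite malgUU_mul !cU malgUU_mul mulrCA.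
Qed.

HB.instance Definition _ := GRing.Lalgebra_isAlgebra.Build K freeAlg free_scalerAr.

Lemma wdegM (w w' : {fmonom gen}) : wdeg (mmul w w') = wdeg w + wdeg w'.
Proof. by rewrite /wdeg fmM big_cat. Qed.

Lemma free_homogP d (f : freeAlg) :
  homog d f <-> forall w, wdeg w != d -> f@_w = 0.
Proof.
split=> [hf w /negPf wd|hf].
  by rewrite -hf [LHS]free_hcomp_coeff wd.
apply/malgP => w; rewrite [LHS]free_hcomp_coeff.
by case: eqP => // /eqP /hf ->.
Qed.

Lemma free_homog1 : homog 0 (1 : freeAlg).
Proof.
apply/free_homogP => w w0; rewrite mcoeff1; case: eqP => // w1.
by rewrite w1 /wdeg fm1 big_nil eqxx in w0.
Qed.

Lemma free_homogM d e (f g : freeAlg) :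
  homog d f -> homog e g -> homog (d + e) (f * g).
Proof.
move=> /free_homogP hf /free_homogP hg; apply/free_homogP => w wde.
rewrite mcoeffMl big1 // => w1 _; rewrite big1 // => w2 _.
have [ww|_] := eqVneq; last by rewrite mulr0n.
have [w1d|/hf ->] := eqVneq (wdeg w1) d; last by rewrite mul0r mul0rn.
have [w2e|/hg ->] := eqVneq (wdeg w2) e; last by rewrite mulr0 mul0rn.
by rewrite -ww wdegM w1d w2e eqxx in wde.
Qed.

HB.instance Definition _ := isZ22Algebra.Build K freeAlg free_homog1 free_homogM.

End FreeAlgebra.

HB.lock Definition fgen (K : fieldType) (g : gen) : freeAlg K := << fmu g >>.

Lemma homog_fgen (K : fieldType) g : homog (gdeg g) (fgen K g).
Proof.
apply/free_homogP => w wg; rewrite fgen.unlock mcoeffU.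
have [wE|//] := eqVneq (fmu g) w; move: wg.
by rewrite -wE /wdeg fmU big_seq1 eqxx.
Qed.

Section QuantumSuperplane.
Variables (K : fieldType) (q : K).

Local Notation x := (fgen K Gx).
Local Notation xi := (fgen K Gxi).
Local Notation theta := (fgen K Gtheta).
Local Notation z := (fgen K Gz).

(* [superplane_rel a] stands for the relation [a = 0]. *)
Variant superplane_rel : freeAlg K -> Prop :=
| rel_x_xi : superplane_rel (x * xi - q *: (xi * x))
| rel_x_theta : superplane_rel (x * theta - q *: (theta * x))
| rel_x_z : superplane_rel (x * z - z * x)
| rel_xi_xi : superplane_rel (xi ^+ 2)
| rel_theta_theta : superplane_rel (theta ^+ 2)
| rel_xi_theta : superplane_rel (xi * theta - theta * xi)
| rel_xi_z : superplane_rel (xi * z - (- q^-1) *: (z * xi))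
| rel_theta_z : superplane_rel (theta * z - (- q^-1) *: (z * theta)).

Lemma superplane_rel_homog : relations_homog superplane_rel.
Proof.
have hB d c (a b : freeAlg K) : homog d a -> homog d b -> homog d (a - c *: b).
  move=> ha hb; rewrite /homog (linB (hcomp_lin d)) (linZ (hcomp_lin d)).
  by rewrite ha hb.
have hM g h : homog (gdeg g + gdeg h) (fgen K g * fgen K h).
  by apply: homogM; apply: homog_fgen.
have hC g h : homog (gdeg g + gdeg h) (fgen K h * fgen K g).
  by rewrite addrC; apply: hM.
have hS g h c : exists d, homog d (fgen K g * fgen K h - c *: (fgen K h * fgen K g)).
  by exists (gdeg g + gdeg h); apply: hB; [apply: hM | apply: hC].
move=> _ [] //.
- by rewrite -[z * x]scale1r; apply: hS.
- by exists (gdeg Gxi + gdeg Gxi); apply: hM.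
- by exists (gdeg Gtheta + gdeg Gtheta); apply: hM.
- by rewrite -[theta * xi]scale1r; apply: hS.
Qed.

Lemma superplane_rel_proper : relations_proper superplane_rel.
Proof.
pose w1 : {fmonom gen} := mone.
pose c0 (f : freeAlg K) : K := f@_w1.
have c0M f g : c0 (f * g) = c0 f * c0 g by apply: (rmorphM (@mcoeff _ K w1)).
have c0gen g : c0 (fgen K g) = 0.
  rewrite /c0 fgen.unlock mcoeffU; have [e|//] := eqVneq (fmu g) w1.
  by move: (fdegU g); rewrite e fdeg1.
have c0B f g : c0 (f - g) = c0 f - c0 g by apply: mcoeffB.
have c0Z c f : c0 (c *: f) = c * c0 f by apply: mcoeffZ.
have c0D f g : c0 (f + g) = c0 f + c0 g by apply: mcoeffD.
have c00 : c0 0 = 0 by apply: mcoeff0.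
have c01 : c0 1 = 1 by rewrite /c0 mcoeff1 eqxx.
clearbody c0; suff H f : span (ideal_gen superplane_rel) f -> c0 f = 0.
  by move=> /H /eqP; rewrite c01; apply/negP/oner_neq0.
elim=> [_ [a [r [b [Sr ->]]]]||v w _ hv _ hw|c v _ hv].
- suff r0 : c0 r = 0 by rewrite (c0M (a * r)) (c0M a) r0 mulr0 mul0r.
  have cM g h : c0 (fgen K g * fgen K h) = 0 by rewrite c0M c0gen mul0r.
  have cB g h c : c0 (fgen K g * fgen K h - c *: (fgen K h * fgen K g)) = 0.
    by rewrite (c0B (fgen K g * fgen K h)) (c0Z c (fgen K h * fgen K g)) !cM
               mulr0 subr0.
  case: Sr; try exact: cB; try exact: cM.
    by rewrite -[z * x]scale1r; apply: cB.
  by rewrite -[theta * xi]scale1r; apply: cB.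
- exact: c00.
- by rewrite c0D hv hw addr0.
- by rewrite c0Z hv mulr0.
Qed.

Definition superplane : Type :=
  aquot superplane_rel_homog superplane_rel_proper.
HB.instance Definition _ := Z22Algebra.on superplane.

Definition sgen (g : gen) : superplane :=
  api superplane_rel_homog superplane_rel_proper (fgen K g).

Definition sp_x : superplane := sgen Gx.
Definition sp_xi : superplane := sgen Gxi.
Definition sp_theta : superplane := sgen Gtheta.
Definition sp_z : superplane := sgen Gz.

Definition superplane_coproduct (Delta : superplane -> superplane ⊗ superplane) :
    Prop :=
  [/\ Delta sp_x = sp_x ⊗ sp_x,
      Delta sp_xi = sp_x ⊗ sp_xi + sp_xi ⊗ sp_x,
      Delta sp_theta = sp_x ⊗ sp_theta + sp_theta ⊗ sp_x &
      Delta sp_z = sp_x ⊗ sp_z + sp_z ⊗ sp_x].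

Definition superplane_counit (eps : superplane -> K^o) : Prop :=
  [/\ eps sp_x = 1, eps sp_xi = 0, eps sp_theta = 0 & eps sp_z = 0].

End QuantumSuperplane.

(* Main.v *)
(** A morphism out of an algebra given by generators and relations is determined
    by the images of the generators, which only have to satisfy the relations.
    Here [Delta x] is group-like and the other [Delta g] are
    [x ⊗ g + g ⊗ x]; two such elements [a], [b] multiply to
      [(x x) ⊗ (a b) + (a b) ⊗ (x x) + (-1)^<deg a, deg b> (x b) ⊗ (a x) + (a x) ⊗ (x b)],
    so that each relation reduces, after moving [x] to the right, to a scalar
    identity in which the sign of the graded tensor product compensates the
    commutation factor.  Both sides of each bialgebra axiom are again morphisms
    of algebras, hence are compared on generators only. *)
From HB Require Import structures.
Require Import Defs.
From mathcomp Require Import all_boot all_order all_algebra.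
From mathcomp Require Import reals complex.
From mathcomp Require Import finmap monalg.

Set Implicit Arguments.
Unset Strict Implicit.
Unset Printing Implicit Defensive.

Import GRing.Theory Num.Theory.
Local Open Scope ring_scope.

(** * Algebra morphisms between graded tensor products *)

Section TensorMorphisms.
Variable K : fieldType.
Implicit Types A B C D : z22AlgType K.

Lemma unital_alg_morphism_id A : unital_alg_morphism (id : A -> A).
Proof. by []. Qed.

Lemma unital_alg_morphism_comp A B C (g : B -> C) (f : A -> B) :
  unital_alg_morphism g -> unital_alg_morphism f ->
  unital_alg_morphism (fun a => g (f a)).
Proof.
move=> [lg [g1 gM]] [lf [f1 fM]].
by split=> [c a b|]; [rewrite lf lg | split=> [|a b]; rewrite ?f1 ?fM].
Qed.

Lemma tens1 A B : (1 : A ⊗ B) = 1 ⊗ 1.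
Proof. by []. Qed.

Lemma tens_mul A B i j (a : A) (b : B) (c : A) (d : B) :
  homog i b -> homog j c ->
  (a ⊗ b) * (c ⊗ d) = Z22sign K i j *: ((a * c) ⊗ (b * d)).
Proof. exact: tensor_mul_tens. Qed.

(** Multiplicativity is additive in each argument, so it may be tested on pure tensors with
    homogeneous factors, where [tens_mul] gives the product with an explicit sign. *)
Lemma linear_tens_morphism A B C (F : A ⊗ B -> C) :
  linear F -> F (1 ⊗ 1) = 1 ->
  (forall i j k l (a : A) (b : B) (c : A) (d : B),
     homog i a -> homog j b -> homog k c -> homog l d ->
     F ((a ⊗ b) * (c ⊗ d)) = F (a ⊗ b) * F (c ⊗ d)) ->
  unital_alg_morphism F.
Proof.
move=> lF F1 FM; split=> //; split=> // s t.
elim/tensor_ind_homog: s => [|s s' hs hs'|i j a b ha hb].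
- by rewrite mul0r (lin0 lF) mul0r.
- by rewrite mulrDl !(linD lF) hs hs' mulrDl.
elim/tensor_ind_homog: t => [|t t' ht ht'|k l c d hc hd].
- by rewrite mulr0 (lin0 lF) mulr0.
- by rewrite mulrDr !(linD lF) ht ht' mulrDr.
exact: (FM _ _ _ _ _ _ _ _ ha hb hc hd).
Qed.

Lemma tmap_bilin (V W V' W' : lmodType K) (f : V -> V') (g : W -> W') :
  linear f -> linear g -> bilin (fun v w => f v ⊗ g w).
Proof.
by move=> lf lg; split=> [w c v v'|v c w w']; rewrite ?lf ?lg ?tens_linl ?tens_linr.
Qed.

Lemma tmap_tens (V W V' W' : lmodType K) (f : V -> V') (g : W -> W') v w :
  linear f -> linear g -> tmap f g (v ⊗ w) = f v ⊗ g w.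
Proof. by move=> lf lg; rewrite /tmap (tlift_tens (tmap_bilin lf lg)). Qed.

Lemma tmap_lin (V W V' W' : lmodType K) (f : V -> V') (g : W -> W') :
  linear f -> linear g -> linear (tmap f g).
Proof. by move=> lf lg; apply: tlift_lin; apply: tmap_bilin. Qed.

(** The sign of a product depends only on the degrees of the two inner factors; [f] and [g] preserve
    degrees, so the same sign appears on both sides. *)
Lemma tmap_morphism A B C D (f : A -> C) (g : B -> D) :
  unital_alg_morphism f -> unital_alg_morphism g ->
  (forall d a, homog d a -> homog d (f a)) ->
  (forall d b, homog d b -> homog d (g b)) ->
  unital_alg_morphism (tmap f g).
Proof.
move=> [lf [f1 fM]] [lg [g1 gM]] hf hg.
apply: linear_tens_morphism; first exact: tmap_lin.
  by rewrite tmap_tens // f1 g1.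
move=> i j k l a b c d ha hb hc hd.
rewrite (tens_mul _ _ hb hc) (linZ (tmap_lin lf lg)) !tmap_tens // fM gM.
by rewrite (tens_mul _ _ (hg _ _ hb) (hf _ _ hc)).
Qed.

Lemma tassoc_inner_bilin (U V W : lmodType K) (w : W) :
  bilin (fun (u : U) (v : V) => u ⊗ (v ⊗ w)).
Proof.
split=> [v c u u'|u c v v']; first exact: tens_linl.
by rewrite tens_linl tens_linr.
Qed.

Lemma tassoc_bilin (U V W : lmodType K) :
  bilin (fun (t : U ⊗ V) (w : W) => tlift (fun u v => u ⊗ (v ⊗ w)) t).
Proof.
split=> [w|t c w w']; first exact: tlift_lin (tassoc_inner_bilin U V w).
elim/tensor_ind: t => [|s t hs ht|u v].
- by rewrite !(lin0 (tlift_lin (tassoc_inner_bilin U V _))) scaler0 addr0.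
- rewrite !(linD (tlift_lin (tassoc_inner_bilin U V _))) hs ht scalerDr.
  exact: addrACA.
- rewrite !(tlift_tens (tassoc_inner_bilin U V _)).
  by rewrite !tens_linr.
Qed.

Lemma tassoc_lin (U V W : lmodType K) : linear (@tassoc K U V W).
Proof. exact: tlift_lin (tassoc_bilin U V W). Qed.

Lemma tassoc_tens (U V W : lmodType K) (u : U) (v : V) (w : W) :
  tassoc ((u ⊗ v) ⊗ w) = u ⊗ (v ⊗ w).
Proof.
by rewrite /tassoc (tlift_tens (tassoc_bilin U V W)) (tlift_tens (tassoc_inner_bilin U V w)).
Qed.

(** In either bracketing, multiplying two triple tensors moves [b] past [a'] and [c] past both [a']
    and [b']; biadditivity of the pairing makes the signs agree. *)
Lemma tassoc_morphism A B C : unital_alg_morphism (@tassoc K A B C).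
Proof.
have lT : linear (@tassoc K A B C) by exact: tassoc_lin.
split=> //; split; last first; last by rewrite !tens1 tassoc_tens.
move=> s t.
elim/tensor_ind_homog: s => [|s s' hs hs'|_ k s c _ hc].
- by rewrite mul0r (lin0 lT) mul0r.
- by rewrite mulrDl !(linD lT) hs hs' mulrDl.
elim/tensor_ind_homog: t => [|t t' ht ht'|_ k' t c' _ hc'].
- by rewrite mulr0 (lin0 lT) mulr0.
- by rewrite mulrDr !(linD lT) ht ht' mulrDr.
(* The degree of the left factor in [A ⊗ B] was dropped, as an arbitrary decomposition need not
   respect it; this second induction supplies homogeneous factors anew. *)
elim/tensor_ind_homog: s => [|s s' hs hs'|i j a b ha hb].
- by rewrite tens0l mul0r (lin0 lT) mul0r.
- by rewrite tensDl mulrDl !(linD lT) hs hs' mulrDl.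
elim/tensor_ind_homog: t => [|t t' ht ht'|i' j' a' b' ha' hb'].
- by rewrite tens0l mulr0 (lin0 lT) mulr0.
- by rewrite tensDl mulrDr !(linD lT) ht ht' mulrDr.
rewrite (tens_mul _ _ hc (homog_tens ha' hb')) (tens_mul _ _ hb ha').
rewrite tensZl !(linZ lT) !tassoc_tens.
rewrite (tens_mul _ _ (homog_tens hb hc) ha') (tens_mul _ _ hc hb').
rewrite tensZr !scalerA Z22signDl Z22signDr; congr (_ *: _).
by rewrite mulrC mulrA.
Qed.

Lemma lunit_bilin (V : lmodType K) : bilin (fun (c : K^o) (v : V) => (c : K) *: v).
Proof.
split=> [v c a b|a c v v']; first by rewrite scalerDl scalerA.
by rewrite scalerDr !scalerA mulrC.
Qed.

Lemma runit_bilin (V : lmodType K) : bilin (fun (v : V) (c : K^o) => (c : K) *: v).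
Proof. by have [h h'] := lunit_bilin V; split. Qed.

Lemma lunit_tens (V : lmodType K) (c : K^o) (v : V) : lunit (c ⊗ v) = (c : K) *: v.
Proof. by rewrite /lunit (tlift_tens (lunit_bilin V)). Qed.

Lemma runit_tens (V : lmodType K) (c : K^o) (v : V) : runit (v ⊗ c) = (c : K) *: v.
Proof. by rewrite /runit (tlift_tens (runit_bilin V)). Qed.

Lemma homog_triv d (c : K^o) : homog d c -> c = 0 \/ d = 0.
Proof.
rewrite /homog /hcomp /= /triv_hcomp; case: eqP => [->|_ <-]; [by right | by left].
Qed.

(** The base field lies in degree 0: a homogeneous scalar is either zero or of degree 0, and then
    crossing it costs no sign. *)
Lemma lunit_morphism A : unital_alg_morphism (@lunit K A).
Proof.
have lT : linear (@lunit K A) by exact: tlift_lin (lunit_bilin A).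
apply: linear_tens_morphism => //; first by rewrite lunit_tens scale1r.
move=> i j k l a b c d ha hb hc hd.
have [->|k0] := homog_triv hc.
  by rewrite tens0l mulr0 (lin0 lT) mulr0.
rewrite (tens_mul _ _ hb hc) k0 Z22sign0r scale1r !lunit_tens.
by rewrite -scalerAl -scalerAr scalerA.
Qed.

Lemma runit_morphism A : unital_alg_morphism (@runit K A).
Proof.
have lT : linear (@runit K A) by exact: tlift_lin (runit_bilin A).
apply: linear_tens_morphism => //; first by rewrite runit_tens scale1r.
move=> i j k l a b c d ha hb hc hd.
have [->|j0] := homog_triv hb.
  by rewrite tens0r mul0r (lin0 lT) mul0r.
rewrite (tens_mul _ _ hb hc) j0 Z22sign0l scale1r !runit_tens.
by rewrite -scalerAl -scalerAr scalerA.
Qed.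

(** Left multiplication by an element of degree [e] shifts every component by [e]. This is the
    inductive step for proving that a morphism preserves degrees. *)
Lemma hcompMl A d e (a b : A) : homog e a -> hcomp d (a * b) = a * hcomp (d - e) b.
Proof.
move=> ha; rewrite -[b in LHS]hcomp_sum mulr_sumr (lin_sum (hcomp_lin d)).
rewrite (bigD1 (d - e)) //= big1 ?addr0 => [|i ne].
  by rewrite (hcomp_homog _ (homogM ha (homog_hcomp _ _))) addrC subrK eqxx.
rewrite (hcomp_homog _ (homogM ha (homog_hcomp _ _))) addrC -subr_eq eq_sym.
by rewrite (negPf ne).
Qed.

End TensorMorphisms.

(** * Universal property of the free algebra, and induction on it *)

Section FreeAlgebraLift.
Variables (K : fieldType) (B : algType K) (phi : gen -> B).

Definition word_prod (w : {fmonom gen}) : B := \prod_(g <- (w : seq gen)) phi g.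

Lemma word_prod_morphism : mmorphism word_prod.
Proof.
by split=> [w w'|]; rewrite /word_prod ?fmM ?big_cat ?fm1 ?big_nil.
Qed.

HB.instance Definition _ := isMultiplicative.Build _ _ word_prod word_prod_morphism.

Definition free_lift : freeAlg K -> B := mmap (in_alg B) word_prod.

Lemma free_lift_linear : linear free_lift.
Proof.
move=> c f g; rewrite /free_lift mmapD mmapZ /=.
by rewrite -scalerAl mul1r.
Qed.

Lemma free_lift_monoid_morphism : monoid_morphism free_lift.
Proof.
have h : multiplicative free_lift.
  (* [B] need not be commutative; it is enough that the images of the coefficients are scalar
     multiples of 1, hence central. *)
  apply: commr_mmap_is_multiplicative => f w c /=.
  by rewrite /GRing.comm -!scalerAl -!scalerAr !mul1r !mulr1.
by split; [exact: h.2 | exact: h.1].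
Qed.

Lemma free_lift_fgen g : free_lift (fgen K g) = phi g.
Proof. by rewrite fgen.unlock /free_lift mmapU /= scale1r mul1r /word_prod fmU big_seq1. Qed.

End FreeAlgebraLift.

Lemma free_ind (K : fieldType) (P : freeAlg K -> Prop) :
  P 0 -> (forall f g, P f -> P g -> P (f + g)) ->
  (forall c f, P f -> P (c *: f)) -> P 1 ->
  (forall g f, P f -> P (fgen K g * f)) -> forall f, P f.
Proof.
move=> P0 PD PZ P1 PM f; rewrite [f]monalgE; elim/big_ind: _ => // w _.
have -> : << f@_w *g w >> = f@_w *: (<< w >> : freeAlg K).
  by apply/malgP => k; rewrite mcoeffZ !mcoeffU mulrnAr mulr1.
apply: PZ; case: w => w; elim: w => [|g w IH].
  by rewrite -fmoneE.
have -> : << FMonom (g :: w) >> = fgen K g * (<< FMonom w >> : freeAlg K).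
  rewrite fgen.unlock malgUU_mul mulr1; congr << _ >>.
  by apply: val_inj; rewrite [RHS]fmM fmU.
exact: PM.
Qed.

(** * Morphisms out of an algebra with given generators *)

Section Generators.
Variables (K : fieldType) (A : z22AlgType K) (I : Type) (e : I -> A).

(** Generation is encoded as an induction principle. Closure under left multiplication by generators
    suffices, because words can be built letter by letter from the left. *)
Definition generated_by : Prop := forall P : A -> Prop,
  P 0 -> (forall u v, P u -> P v -> P (u + v)) ->
  (forall c u, P u -> P (c *: u)) -> P 1 ->
  (forall i u, P u -> P (e i * u)) -> forall u, P u.

Hypothesis gen_e : generated_by.

Lemma generated_morphism_ext (B : z22AlgType K) (F G : A -> B) :
  unital_alg_morphism F -> unital_alg_morphism G ->
  (forall i, F (e i) = G (e i)) -> forall u, F u = G u.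
Proof.
move=> [lF [F1 FM]] [lG [G1 GM]] FG u.
elim/gen_e: u => [|u v hu hv|c u hu||i u hu].
- by rewrite (lin0 lF) (lin0 lG).
- by rewrite (linD lF) (linD lG) hu hv.
- by rewrite (linZ lF) (linZ lG) hu.
- by rewrite F1 G1.
- by rewrite FM GM FG hu.
Qed.

Variable deg : I -> Z22.
Hypothesis deg_e : forall i, homog (deg i) (e i).

Lemma generated_morphism_homog (B : z22AlgType K) (F : A -> B) :
  unital_alg_morphism F -> (forall i, homog (deg i) (F (e i))) ->
  forall d u, homog d u -> homog d (F u).
Proof.
(* Homogeneity is not inherited by the pieces of [u] in the induction. The goal is therefore turned
   into [hcomp d (F u) = F (hcomp d u)], which makes sense for every [u] and [d]. *)
move=> [lF [F1 FM]] hF d u hu; rewrite /homog -[u in RHS]hu.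
elim/gen_e: u {hu} d => [|u v hu hv|c u hu||i u hu] d.
- by rewrite !(lin0 (hcomp_lin _), lin0 lF).
- by rewrite !(linD (hcomp_lin _), linD lF) hu hv.
- by rewrite !(linZ (hcomp_lin _), linZ lF) hu.
- rewrite F1 !(hcomp_homog _ (homog1 _)); case: ifP => _; last by rewrite (lin0 lF).
  by rewrite F1.
- by rewrite FM (hcompMl _ _ (hF i)) hu (hcompMl _ _ (deg_e i)) FM.
Qed.

Lemma generated_bialgebra (Delta : A -> A ⊗ A) (eps : A -> K^o) :
  unital_alg_morphism Delta -> unital_alg_morphism eps ->
  (forall i, homog (deg i) (Delta (e i))) ->
  (forall i, homog (deg i) (eps (e i))) ->
  (forall i, tassoc (tmap Delta id (Delta (e i))) = tmap id Delta (Delta (e i))) ->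
  (forall i, lunit (tmap eps id (Delta (e i))) = e i) ->
  (forall i, runit (tmap id eps (Delta (e i))) = e i) ->
  Z22bialgebra Delta eps.
Proof.
move=> mD mE hDe hEe coassoc counitl counitr.
(* Degree preservation comes first: [tmap_morphism] needs it before the two sides of the coalgebra
   axioms can be recognised as morphisms. *)
have hD := generated_morphism_homog mD hDe.
have hE := generated_morphism_homog mE hEe.
have mI := unital_alg_morphism_id A.
have hI d (c : A) : homog d c -> homog d (id c) by [].
split=> //; split=> //.
- exact: mD.1.
- exact: mE.1.
- apply: generated_morphism_ext; last exact: coassoc.
    apply: (unital_alg_morphism_comp (tassoc_morphism A A A)).
    exact: (unital_alg_morphism_comp (tmap_morphism mD mI hD hI) mD).
  exact: (unital_alg_morphism_comp (tmap_morphism mI mD hI hD) mD).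
- apply: (generated_morphism_ext (G := id) _ mI counitl).
  apply: (unital_alg_morphism_comp (lunit_morphism A)).
  exact: (unital_alg_morphism_comp (tmap_morphism mE mI hE hI) mD).
- apply: (generated_morphism_ext (G := id) _ mI counitr).
  apply: (unital_alg_morphism_comp (runit_morphism A)).
  exact: (unital_alg_morphism_comp (tmap_morphism mI mE hI hE) mD).
Qed.

End Generators.

(** An element [a] with this coproduct is (x,x)-primitive in Hopf algebra terms; [x = 1] would give
    the ordinary primitive elements. *)
Definition skew_primitive (K : fieldType) (V : lmodType K) (x a : V) : (V ⊗ V)%type :=
  x ⊗ a + a ⊗ x.

(** * Coalgebra axioms on group-like and skew-primitive elements *)

Section SkewPrimitiveCoalgebra.
Variables (K : fieldType) (C : lmodType K) (Delta : C -> (C ⊗ C)%type) (eps : C -> K^o).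
Hypotheses (lD : linear Delta) (lE : linear eps).
Variables (x a : C).
Hypotheses (Dx : Delta x = x ⊗ x) (ex : eps x = 1).

Let lI : linear (id : C -> C). Proof. by []. Qed.

Lemma group_like_coassoc : tassoc (tmap Delta id (Delta x)) = tmap id Delta (Delta x).
Proof. by rewrite Dx !tmap_tens // Dx tassoc_tens. Qed.

Lemma group_like_counit_l : lunit (tmap eps id (Delta x)) = x.
Proof. by rewrite Dx tmap_tens // ex lunit_tens scale1r. Qed.

Lemma group_like_counit_r : runit (tmap id eps (Delta x)) = x.
Proof. by rewrite Dx tmap_tens // ex runit_tens scale1r. Qed.

Hypotheses (Da : Delta a = skew_primitive x a) (ea : eps a = 0).

(** Both sides expand to the sum of the three tensors with [a] in one position and [x] in the other
    two. *)
Lemma skew_primitive_coassoc : tassoc (tmap Delta id (Delta a)) = tmap id Delta (Delta a).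
Proof.
rewrite Da /skew_primitive (linD (tmap_lin lD lI)) (linD (tmap_lin lI lD)) !tmap_tens // Dx Da.
by rewrite tensDl tensDr !(linD (@tassoc_lin K C C C)) !tassoc_tens addrA.
Qed.

Lemma skew_primitive_counit_l : lunit (tmap eps id (Delta a)) = a.
Proof.
rewrite Da /skew_primitive (linD (tmap_lin lE lI)) !tmap_tens // ex ea tens0l addr0.
by rewrite lunit_tens scale1r.
Qed.

Lemma skew_primitive_counit_r : runit (tmap id eps (Delta a)) = a.
Proof.
rewrite Da /skew_primitive (linD (tmap_lin lI lE)) !tmap_tens // ex ea tens0r add0r.
by rewrite runit_tens scale1r.
Qed.

End SkewPrimitiveCoalgebra.

(** * Relations satisfied by group-like and skew-primitive coproducts *)

Section CoproductRelations.
Variables (K : fieldType) (A : z22AlgType K) (x : A).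
Hypothesis hx : homog 0 x.

Local Notation D := (skew_primitive x).

Lemma skew_primitive_homog i a : homog i a -> homog i (D a).
Proof.
move=> ha; have h1 := homog_tens hx ha; have h2 := homog_tens ha hx.
by rewrite add0r in h1; rewrite addr0 in h2; rewrite /homog (linD (hcomp_lin i)) h1 h2.
Qed.

Lemma group_like_mul_skew_primitive i a : homog i a ->
  (x ⊗ x) * D a = (x * x) ⊗ (x * a) + (x * a) ⊗ (x * x).
Proof.
by move=> ha; rewrite mulrDr (tens_mul _ _ hx hx) (tens_mul _ _ hx ha) !Z22sign0l !scale1r.
Qed.

Lemma skew_primitive_mul_group_like i a : homog i a ->
  D a * (x ⊗ x) = (x * x) ⊗ (a * x) + (a * x) ⊗ (x * x).
Proof.
by move=> ha; rewrite mulrDl (tens_mul _ _ ha hx) (tens_mul _ _ hx hx) !Z22sign0r !scale1r.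
Qed.

Lemma skew_primitive_mul i j a b : homog i a -> homog j b ->
  D a * D b = (x * x) ⊗ (a * b) + (a * b) ⊗ (x * x) +
    (Z22sign K i j *: ((x * b) ⊗ (a * x)) + (a * x) ⊗ (x * b)).
Proof.
move=> ha hb; rewrite mulrDl !mulrDr (tens_mul _ _ ha hx) (tens_mul _ _ ha hb).
rewrite (tens_mul _ _ hx hx) (tens_mul _ _ hx hb) Z22sign0r !Z22sign0l !scale1r.
by rewrite [X in _ + X = _]addrC addrACA.
Qed.

Lemma skew_primitive_x_comm i (c : K) a : homog i a -> x * a = c *: (a * x) ->
  (x ⊗ x) * D a = c *: (D a * (x ⊗ x)).
Proof.
move=> ha r; rewrite (group_like_mul_skew_primitive ha) (skew_primitive_mul_group_like ha).
by rewrite r tensZl tensZr scalerDr.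
Qed.

(** The outer terms vanish with [a * a]; the two mixed terms are both [c] times [(a * x) ⊗ (a * x)],
    with opposite signs. *)
Lemma skew_primitive_sqr i (c : K) a : homog i a -> Z22sign K i i = -1 ->
  x * a = c *: (a * x) -> a * a = 0 -> D a * D a = 0.
Proof.
move=> ha si r r2; rewrite (skew_primitive_mul ha ha) si r2 r tens0l tens0r !add0r.
by rewrite tensZl tensZr scaleN1r addNr.
Qed.

(** The outer terms match by the relation between [a] and [b]. The two scalar hypotheses equate the
    coefficients of the mixed terms [(b * x) ⊗ (a * x)] and [(a * x) ⊗ (b * x)]. *)
Lemma skew_primitive_comm i j (c d e : K) a b : homog i a -> homog j b ->
  x * a = c *: (a * x) -> x * b = d *: (b * x) -> a * b = e *: (b * a) ->
  Z22sign K i j * d = e * c -> d = e * (Z22sign K j i * c) ->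
  D a * D b = e *: (D b * D a).
Proof.
move=> ha hb ra rb rab e1 e2; rewrite (skew_primitive_mul ha hb) (skew_primitive_mul hb ha).
rewrite ra rb rab !tensZl !tensZr !scalerA e1 !scalerDr !scalerA -e2.
by congr (_ + _); rewrite addrC.
Qed.

End CoproductRelations.

(** * Bialgebras with one group-like generator and skew-primitive others *)

Section SkewPrimitiveGenerators.
Variables (K : fieldType) (A : z22AlgType K) (I : eqType) (e : I -> A) (deg : I -> Z22).
Variable (i0 : I).
Hypotheses (gen_e : generated_by e) (deg_e : forall i, homog (deg i) (e i)).
Hypothesis deg0 : deg i0 = 0.

Definition generator_coproduct i : A ⊗ A :=
  if i == i0 then e i0 ⊗ e i0 else skew_primitive (e i0) (e i).

Let h0 : homog 0 (e i0). Proof. by rewrite -deg0. Qed.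

Lemma generator_coproduct_bialgebra (Delta : A -> A ⊗ A) (eps : A -> K^o) :
  unital_alg_morphism Delta -> (forall i, Delta (e i) = generator_coproduct i) ->
  unital_alg_morphism eps -> (forall i, eps (e i) = (i == i0)%:R) ->
  Z22bialgebra Delta eps.
Proof.
move=> mD De mE ee; have [lD _] := mD; have [lE _] := mE.
have D0 : Delta (e i0) = e i0 ⊗ e i0 by rewrite De /generator_coproduct eqxx.
have e0 : eps (e i0) = 1 by rewrite ee eqxx.
have DN i : i != i0 -> Delta (e i) = skew_primitive (e i0) (e i).
  by rewrite De /generator_coproduct => /negPf ->.
have eN i : i != i0 -> eps (e i) = 0 by rewrite ee => /negPf ->.
apply: (generated_bialgebra gen_e deg_e mD mE) => i; have [->|ne] := eqVneq i i0.
- by rewrite D0 deg0; have := homog_tens h0 h0; rewrite addr0.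
- by rewrite DN //; apply: skew_primitive_homog.
- by rewrite e0 deg0; apply: homog1.
- by rewrite eN //; apply: (lin0 (hcomp_lin _)).
- exact: group_like_coassoc.
- by apply: (skew_primitive_coassoc lD D0); apply: DN.
- exact: group_like_counit_l.
- by apply: (skew_primitive_counit_l lE e0); [apply: DN | apply: eN].
- exact: group_like_counit_r.
- by apply: (skew_primitive_counit_r lE e0); [apply: DN | apply: eN].
Qed.

End SkewPrimitiveGenerators.

(** * The superplane relations and their stability under the coproduct *)

Section SuperplaneRelations.
Variables (K : fieldType) (q : K).

(** Stated for any family in any algebra, so as to apply to the generators and to their prospective
    images under the coproduct and the counit. *)
Definition superplane_relations (B : algType K) (phi : gen -> B) : Prop :=
  let x := phi Gx in let xi := phi Gxi in let theta := phi Gtheta in let z := phi Gz in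
  [/\ [/\ x * xi = q *: (xi * x), x * theta = q *: (theta * x) & x * z = z * x],
      [/\ xi * xi = 0, theta * theta = 0 & xi * theta = theta * xi],
      xi * z = - q^-1 *: (z * xi) & theta * z = - q^-1 *: (z * theta)].

Lemma generator_coproduct_relations (A : z22AlgType K) (phi : gen -> A) :
  q != 0 -> (forall g, homog (gdeg g) (phi g)) -> superplane_relations phi ->
  superplane_relations (generator_coproduct phi Gx).
Proof.
move=> q0 hg [[r1 r2 r3] [r4 r5 r6] r7 r8]; have hx : homog 0 (phi Gx) := hg Gx.
(* Plain commutation is rewritten as commutation up to the factor 1, the form required by the lemmas
   on skew-primitive elements. *)
rewrite -[RHS]scale1r in r3; rewrite -[RHS]scale1r in r6.
(* The degrees of [xi] and [theta] both pair to 1 with that of [z], giving the sign -1. These are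
   the two scalar conditions of [skew_primitive_comm] with [c = q], [d = 1], [e = - q^-1]. *)
have hz : -1 * 1 = - q^-1 * q :> K by rewrite mulr1 mulNr mulVf.
have hz' : 1 = - q^-1 * (-1 * q) :> K by rewrite mulN1r mulrNN mulVf.
split; first split.
- exact: skew_primitive_x_comm (hg Gxi) r1.
- exact: skew_primitive_x_comm (hg Gtheta) r2.
- by rewrite -[RHS]scale1r; exact: skew_primitive_x_comm (hg Gz) r3.
- split.
  + exact: (skew_primitive_sqr hx (hg Gxi) _ r1 r4).
  + exact: (skew_primitive_sqr hx (hg Gtheta) _ r2 r5).
  + rewrite -[RHS]scale1r.
    apply: (skew_primitive_comm hx (hg Gxi) (hg Gtheta) r1 r2 r6) => //.
    by rewrite !mul1r.
- exact: (skew_primitive_comm hx (hg Gxi) (hg Gz) r1 r3 r7 hz hz').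
- exact: (skew_primitive_comm hx (hg Gtheta) (hg Gz) r2 r3 r8 hz hz').
Qed.

End SuperplaneRelations.

(** * Presentation of the superplane, its coproduct and its counit *)

Section Superplane.
Variables (K : fieldType) (q : K).
Local Notation A := (superplane q).
Local Notation pi := (api (@superplane_rel_homog K q) (@superplane_rel_proper K q)).

Lemma api_morphism : unital_alg_morphism (pi : freeAlg K -> A).
Proof. by split; [exact: api_lin | split=> // a b; rewrite -[RHS]/(aquot_mul _ _) api_mul]. Qed.

Lemma sgen_generated : generated_by (sgen q).
Proof.
move=> P P0 PD PZ P1 PM u; rewrite -[u]areprK; have [lpi [pi1 piM]] := api_morphism.
elim/free_ind: (arepr u) => [|f g Pf Pg|c f Pf||g f Pf].
- by rewrite (lin0 lpi).
- by rewrite (linD lpi); apply: PD.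
- by rewrite (linZ lpi); apply: PZ.
- by rewrite pi1.
- by rewrite piM; apply: PM.
Qed.

Lemma homog_sgen g : homog (gdeg g) (sgen q g).
Proof. by rewrite /homog [LHS]aquot_hcompE (homog_fgen K g). Qed.

Lemma sgen_relations : superplane_relations q (sgen q).
Proof.
have [lpi [pi1 piM]] := api_morphism.
have pi0 r : superplane_rel q r -> pi r = 0.
  move=> hr; rewrite -(lin0 lpi); apply/api_eq; rewrite subr0; apply: span_gen.
  by exists 1, r, 1; rewrite mul1r mulr1.
have piE r s : superplane_rel q (r - s) -> pi r = pi s.
  by move=> /pi0; rewrite (linB lpi) => /eqP; rewrite subr_eq0 => /eqP.
have E g h : sgen q g * sgen q h = pi (fgen K g * fgen K h) by rewrite piM.
have EZ c g h : c *: (sgen q g * sgen q h) = pi (c *: (fgen K g * fgen K h)).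
  by rewrite E (linZ lpi).
rewrite /superplane_relations !EZ !E.
split; first split.
- exact: piE (rel_x_xi q).
- exact: piE (rel_x_theta q).
- exact: piE (rel_x_z q).
- split; first exact: pi0 (rel_xi_xi q).
    exact: pi0 (rel_theta_theta q).
  exact: piE (rel_xi_theta q).
- exact: piE (rel_xi_z q).
- exact: piE (rel_theta_z q).
Qed.

(** Universal property of the presentation: the lift to the free algebra kills the ideal of
    relations, hence descends to the quotient. *)
Lemma superplane_lift (B : z22AlgType K) (phi : gen -> B) :
  superplane_relations q phi ->
  exists F : A -> B, unital_alg_morphism F /\ forall g, F (sgen q g) = phi g.
Proof.
move=> [[r1 r2 r3] [r4 r5 r6] r7 r8].
have [] := (free_lift_linear phi, free_lift_monoid_morphism phi).
move: (free_lift_fgen phi); move: (free_lift phi) => G Gg lG [G1 GM].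
have GP g h : G (fgen K g * fgen K h) = phi g * phi h by rewrite GM !Gg.
have GB f h : G (f - h) = G f - G h by apply: linB.
have GC c g h : G (fgen K g * fgen K h - c *: (fgen K h * fgen K g)) =
    phi g * phi h - c *: (phi h * phi g).
  by rewrite GB (linZ lG); congr (_ - _ *: _); exact: GP.
have G0 v : Defs.span (ideal_gen (@superplane_rel K q)) v -> G v = 0.
  elim=> [_ [a [r [b [Sr ->]]]]||v1 v2 _ h1 _ h2|c v1 _ h1].
  - rewrite !GM; suff -> : G r = 0 by rewrite mulr0 mul0r.
    case: Sr.
    + by rewrite GC r1 subrr.
    + by rewrite GC r2 subrr.
    + by rewrite GB; apply/eqP; rewrite subr_eq0; apply/eqP; rewrite [LHS]GP [RHS]GP.
    + by rewrite expr2 GP.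
    + by rewrite expr2 GP.
    + by rewrite GB; apply/eqP; rewrite subr_eq0; apply/eqP; rewrite [LHS]GP [RHS]GP.
    + by rewrite GC r7 subrr.
    + by rewrite GC r8 subrr.
  - exact: lin0 lG.
  - by rewrite (linD lG) h1 h2 addr0.
  - by rewrite (linZ lG) h1 scaler0.
(* [arepr] picks an arbitrary representative; as [G] kills the ideal, its value does not depend on
   that choice. *)
have Gpi v : G (arepr (pi v)) = G v.
  by apply/eqP; rewrite -subr_eq0 -(linB lG); apply/eqP/G0/rep_api.
have [lpi [pi1 piM]] := api_morphism.
exists (fun u : A =>
  G (@arepr K _ _ (@superplane_rel_homog K q) (@superplane_rel_proper K q) u)); split.
  split=> [c u v|]; last split=> [|u v].
  - by rewrite -[u]areprK -[v]areprK -lpi !Gpi lG.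
  - by rewrite -pi1 Gpi G1.
  - by rewrite -[u]areprK -[v]areprK -piM !Gpi GM.
by move=> g; rewrite /sgen Gpi Gg.
Qed.

Lemma superplane_coproductP (Delta : A -> A ⊗ A) :
  superplane_coproduct Delta <->
  forall g, Delta (sgen q g) = generator_coproduct (sgen q) Gx g.
Proof.
have E0 : sp_x q ⊗ sp_x q = generator_coproduct (sgen q) Gx Gx by [].
have E g : g != Gx ->
    sp_x q ⊗ sgen q g + sgen q g ⊗ sp_x q = generator_coproduct (sgen q) Gx g.
  (* The two sides carry different but convertible module structures on [A];
     [congr] keeps the unifier from unfolding the addition of the tensor product. *)
  by rewrite /generator_coproduct => /negPf ->; rewrite /skew_primitive; congr (_ + _).
rewrite /superplane_coproduct E0 (E Gxi) // (E Gtheta) // (E Gz) //.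
split; first by case=> e1 e2 e3 e4 [].
by move=> e; split; [exact: e Gx | exact: e Gxi | exact: e Gtheta | exact: e Gz].
Qed.

Lemma superplane_counitP (eps : A -> K^o) :
  superplane_counit eps <-> forall g, eps (sgen q g) = (g == Gx)%:R.
Proof.
split; first by case=> e1 e2 e3 e4 [].
by move=> e; split; [exact: e Gx | exact: e Gxi | exact: e Gtheta | exact: e Gz].
Qed.

Lemma superplane_coproduct_exists : q != 0 ->
  exists Delta : A -> A ⊗ A, unital_alg_morphism Delta /\ superplane_coproduct Delta.
Proof.
move=> q0.
have [Delta [mD eD]] :=
  superplane_lift (generator_coproduct_relations q0 homog_sgen sgen_relations).
exists Delta; split; first exact: mD.
exact: (superplane_coproductP Delta).2 eD.
Qed.

Lemma superplane_counit_exists :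
  exists eps : A -> K^o, unital_alg_morphism eps /\ superplane_counit eps.
Proof.
have [|eps [mE eE]] := @superplane_lift K^o (fun g => (g == Gx)%:R).
  (* Every monomial in the relations contains a generator other than [x], so each relation becomes
     [0 = 0]. *)
  by rewrite /superplane_relations /= !mulr0n !(mulr0, mul0r) !scaler0.
by exists eps; split=> //; apply/superplane_counitP.
Qed.

Lemma superplane_bialgebra (Delta : A -> A ⊗ A) (eps : A -> K^o) :
  unital_alg_morphism Delta -> superplane_coproduct Delta ->
  unital_alg_morphism eps -> superplane_counit eps -> Z22bialgebra Delta eps.
Proof.
move=> mD /superplane_coproductP eD mE /superplane_counitP eE.
have d0 : gdeg Gx = 0 by [].
apply: (generator_coproduct_bialgebra sgen_generated homog_sgen d0 mD _ mE eE).
exact: eD.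
Qed.

End Superplane.

Theorem proposition3 (R : realType) (q : R[i]) (q_neq0 : q != 0)
    (q_not_root_of_unity : forall n : nat, (0 < n)%N -> q ^+ n != 1) :
  (exists! Delta : superplane q -> (superplane q ⊗ superplane q)%type,
      unital_alg_morphism Delta /\ superplane_coproduct Delta) /\
  (exists! eps : superplane q -> (R[i])^o,
      unital_alg_morphism eps /\ superplane_counit eps) /\
  (forall (Delta : superplane q -> (superplane q ⊗ superplane q)%type)
          (eps : superplane q -> (R[i])^o),
      unital_alg_morphism Delta -> superplane_coproduct Delta ->
      unital_alg_morphism eps -> superplane_counit eps ->
      Z22bialgebra Delta eps).
Proof.
split; [|split].
- have [D [mD cD]] := superplane_coproduct_exists q_neq0.
  exists D; split=> // D' [mD' cD'].
  (* Uniqueness: both morphisms take the prescribed values on generators. *)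
  apply/boolp.funext; apply: (generated_morphism_ext (@sgen_generated _ q) mD mD') => g.
  by rewrite (proj1 (superplane_coproductP D) cD) (proj1 (superplane_coproductP D') cD').
- have [e [me ce]] := superplane_counit_exists q; exists e; split=> // e' [me' ce'].
  apply/boolp.funext; apply: (generated_morphism_ext (@sgen_generated _ q) me me') => g.
  by rewrite (proj1 (superplane_counitP e) ce) (proj1 (superplane_counitP e') ce').
- exact: superplane_bialgebra.
Qed.
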